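(* Let $\Lambda\subseteq\mathbb H$ be an axially symmetric s-domain, let $\mathbf i,\mathbf j\in\mathbb S^2$ be mutually orthogonal, and consider the basis $\{1,\mathbf i,\mathbf j,\mathbf i\mathbf j\}$ of $\mathbb H$. Then $$\mathcal{SR}(\Lambda)=\mathcal{SR}_c(\Lambda)\oplus\mathcal{SR}_c(\Lambda)\,\mathbf i\oplus\mathcal{SR}_c(\Lambda)\,\mathbf j\oplus\mathcal{SR}_c(\Lambda)\,\mathbf i\mathbf j$$ (direct sum of real vector spaces).
   Context: $\mathbb H$ is the algebra of quaternions and $\mathbb S^2$ is the sphere of purely imaginary unit quaternions. For $\mathbf i\in\mathbb S^2$, $\mathbb C(\mathbf i)$ is the real span of $\{1,\mathbf i\}$ (a copy of $\mathbb C$), and $\Lambda_{\mathbf i}=\Lambda\cap\mathbb C(\mathbf i)$. Every nonreal $q\in\mathbb H$ is written $q=x+I_qy$ with $x=\mathrm{Re}\,q$, $y=\|\vec q\|$ ($\vec q$ the imaginary part), $I_q=\vec q/\|\vec q\|\in\mathbb S^2$; for real $q$, $y=0$ and $I_q$ is arbitrary. A set $\Lambda\subseteq\mathbb H$ is axially symmetric if $x+I_qy\in\Lambda$ implies $x+Iy\in\Lambda$ for all $I\in\mathbb S^2$. It is an s-domain (slice domain) if it is a domain intersecting the real axis and $\Lambda\cap\mathbb C(\mathbf i)$ is connected for all $\mathbf i\in\mathbb S^2$. $\mathcal{SR}(\Lambda)$ is the set of (left) slice regular functions on $\Lambda$: real differentiable $f:\Lambda\to\mathbb H$ such that for every $\mathbf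 i\in\mathbb S^2$, $\left(\frac{\partial}{\partial x}+\mathbf i\frac{\partial}{\partial y}\right)f|_{\Lambda_{\mathbf i}}(x+y\mathbf i)=0$ on $\Lambda_{\mathbf i}$. $\mathcal{SR}_c(\Lambda)$ is the set of $f\in\mathcal{SR}(\Lambda)$ satisfying the quaternionic C-property $f(q)=\overline{f(\bar q)}$ for all $q\in\Lambda$, where the bar is quaternionic conjugation. For $a\in\mathbb H$, $\mathcal{SR}_c(\Lambda)a=\{fa: f\in\mathcal{SR}_c(\Lambda)\}$. *)

(* Defs.v *)
From HB Require Import structures.
From mathcomp Require Import all_boot all_order all_algebra.
From mathcomp Require Import ring lra.
From mathcomp Require Import all_classical all_reals all_analysis.

Set Implicit Arguments.
Unset Strict Implicit.
Unset Printing Implicit Defensive.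

Import Order.TTheory GRing.Theory Num.Theory.
Import numFieldNormedType.Exports.

Local Open Scope classical_set_scope.
Local Open Scope ring_scope.

Record quat (R : Type) := Quat { qre : R; qi : R; qj : R; qk : R }.

Definition prod_of_quat (R : Type) (q : quat R) := (qre q, qi q, qj q, qk q).
Definition quat_of_prod (R : Type) (p : R * R * R * R) :=
  let: (a, b, c, d) := p in Quat a b c d.

Lemma prod_of_quatK (R : Type) : cancel (@prod_of_quat R) (@quat_of_prod R).
Proof. by case. Qed.

HB.instance Definition _ (R : realType) :=
  Choice.copy (quat R) (can_type (@prod_of_quatK R)).

Lemma quat_eqP (R : realType) (p q : quat R) :
  qre p = qre q -> qi p = qi q -> qj p = qj q -> qk p = qk q -> p = q.
Proof. by case: p => ????; case: q => ???? /= -> -> -> ->. Qed.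

Definition addq (R : realType) (p q : quat R) :=
  Quat (qre p + qre q) (qi p + qi q) (qj p + qj q) (qk p + qk q).

Definition oppq (R : realType) (q : quat R) :=
  Quat (- qre q) (- qi q) (- qj q) (- qk q).

Definition mulq (R : realType) (p q : quat R) :=
  Quat (qre p * qre q - qi p * qi q - qj p * qj q - qk p * qk q)
       (qre p * qi q + qi p * qre q + qj p * qk q - qk p * qj q)
       (qre p * qj q - qi p * qk q + qj p * qre q + qk p * qi q)
       (qre p * qk q + qi p * qj q - qj p * qi q + qk p * qre q).

Definition scaleq (R : realType) (a : R) (q : quat R) :=
  Quat (a * qre q) (a * qi q) (a * qj q) (a * qk q).

Lemma addqA (R : realType) : associative (@addq R).
Proof. by move=> p q r; apply: quat_eqP => /=; rewrite addrA. Qed.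

Lemma addqC (R : realType) : commutative (@addq R).
Proof. by move=> p q; apply: quat_eqP => /=; rewrite addrC. Qed.

Lemma add0q (R : realType) : left_id (Quat 0 0 0 0) (@addq R).
Proof. by move=> q; apply: quat_eqP => /=; rewrite add0r. Qed.

Lemma addNq (R : realType) : left_inverse (Quat 0 0 0 0) (@oppq R) (@addq R).
Proof. by move=> q; apply: quat_eqP => /=; rewrite addNr. Qed.

HB.instance Definition _ (R : realType) :=
  GRing.isZmodule.Build (quat R) (@addqA R) (@addqC R) (@add0q R) (@addNq R).

Lemma mulqA (R : realType) : associative (@mulq R).
Proof. by move=> p q r; apply: quat_eqP => /=; ring. Qed.

Lemma mul1q (R : realType) : left_id (Quat 1 0 0 0) (@mulq R).
Proof. by move=> q; apply: quat_eqP => /=; ring. Qed.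

Lemma mulq1 (R : realType) : right_id (Quat 1 0 0 0) (@mulq R).
Proof. by move=> q; apply: quat_eqP => /=; ring. Qed.

Lemma mulqDl (R : realType) : left_distributive (@mulq R) +%R.
Proof. by move=> p q r; apply: quat_eqP => /=; ring. Qed.

Lemma mulqDr (R : realType) : right_distributive (@mulq R) +%R.
Proof. by move=> p q r; apply: quat_eqP => /=; ring. Qed.

Lemma oneq_neq0 (R : realType) : Quat (1 : R) 0 0 0 != 0.
Proof. by apply/eqP => -[/eqP]; rewrite oner_eq0. Qed.

HB.instance Definition _ (R : realType) :=
  GRing.Zmodule_isNzRing.Build (quat R)
    (@mulqA R) (@mul1q R) (@mulq1 R) (@mulqDl R) (@mulqDr R) (@oneq_neq0 R).

Lemma scaleqA (R : realType) (a b : R) (q : quat R) :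
  scaleq a (scaleq b q) = scaleq (a * b) q.
Proof. by apply: quat_eqP => /=; rewrite mulrA. Qed.

Lemma scale1q (R : realType) : left_id 1 (@scaleq R).
Proof. by move=> q; apply: quat_eqP => /=; rewrite mul1r. Qed.

Lemma scaleqDr (R : realType) : right_distributive (@scaleq R) +%R.
Proof. by move=> a p q; apply: quat_eqP => /=; rewrite mulrDr. Qed.

Lemma scaleqDl (R : realType) (q : quat R) :
  {morph (@scaleq R)^~ q : a b / a + b}.
Proof. by move=> a b; apply: quat_eqP => /=; rewrite mulrDl. Qed.

HB.instance Definition _ (R : realType) :=
  GRing.Zmodule_isLmodule.Build R (quat R)
    (@scaleqA R) (@scale1q R) (@scaleqDr R) (@scaleqDl R).

Lemma scaleqAl (R : realType) (a : R) (p q : quat R) :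
  a *: (p * q) = (a *: p) * q.
Proof. by apply: quat_eqP => /=; ring. Qed.

HB.instance Definition _ (R : realType) :=
  GRing.Lmodule_isLalgebra.Build R (quat R) (@scaleqAl R).

Lemma scaleqAr (R : realType) (a : R) (p q : quat R) :
  a *: (p * q) = p * (a *: q).
Proof. by apply: quat_eqP => /=; ring. Qed.

HB.instance Definition _ (R : realType) :=
  GRing.Lalgebra_isAlgebra.Build R (quat R) (@scaleqAr R).

Definition qdot (R : realType) (p q : quat R) : R :=
  qre p * qre q + qi p * qi q + qj p * qj q + qk p * qk q.

Definition normq (R : realType) (q : quat R) : R := Num.sqrt (qdot q q).

Lemma qdot_ge0 (R : realType) (q : quat R) : 0 <= qdot q q.
Proof. by rewrite /qdot -!expr2 !addr_ge0 ?sqr_ge0. Qed.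

Lemma sqr_normq (R : realType) (q : quat R) : normq q ^+ 2 = qdot q q.
Proof. by rewrite sqr_sqrtr ?qdot_ge0. Qed.

Lemma qdot_le (R : realType) (p q : quat R) : qdot p q <= normq p * normq q.
Proof.
rewrite /normq -sqrtrM ?qdot_ge0//; apply: (le_trans (ler_norm _)).
rewrite -sqrtr_sqr ler_sqrt ?mulr_ge0 ?qdot_ge0//.
case: p => a b c d; case: q => x y z t; rewrite /qdot /= -subr_ge0.
have -> : (a * a + b * b + c * c + d * d) * (x * x + y * y + z * z + t * t) -
    (a * x + b * y + c * z + d * t) ^+ 2 =
    (a * y - b * x) ^+ 2 + (a * z - c * x) ^+ 2 + (a * t - d * x) ^+ 2 +
    (b * z - c * y) ^+ 2 + (b * t - d * y) ^+ 2 + (c * t - d * z) ^+ 2 by ring.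
by rewrite !addr_ge0 ?sqr_ge0.
Qed.

Lemma normqD (R : realType) (p q : quat R) : normq (p + q) <= normq p + normq q.
Proof.
rewrite -ler_sqr ?nnegrE ?addr_ge0 ?sqrtr_ge0// sqrrD !sqr_normq.
have -> : qdot (p + q) (p + q) = qdot p p + qdot p q *+ 2 + qdot q q.
  by rewrite /qdot /=; ring.
by rewrite lerD2r lerD2l ler_pMn2r ?qdot_le.
Qed.

Lemma normqZ (R : realType) (a : R) (q : quat R) :
  normq (a *: q) = `|a| * normq q.
Proof.
rewrite -sqrtr_sqr -sqrtrM ?sqr_ge0//; congr Num.sqrt.
by rewrite /qdot /=; ring.
Qed.

Lemma normq_eq0 (R : realType) (q : quat R) : normq q = 0 -> q = 0.
Proof.
move=> /(congr1 (fun x => x ^+ 2)); rewrite sqr_normq expr0n /= /qdot.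
by case: q => a b c d /= h; apply: quat_eqP => /=; nra.
Qed.

HB.instance Definition _ (R : realType) :=
  Lmodule_isNormed.Build R (quat R) (@normqD R) (@normqZ R) (@normq_eq0 R).

Lemma quat_normE (R : realType) (q : quat R) : `|q| = Num.sqrt (qdot q q).
Proof. by []. Qed.

Definition qvec (R : realType) (q : quat R) : quat R :=
  Quat 0 (qi q) (qj q) (qk q).

Definition qconj (R : realType) (q : quat R) : quat R :=
  Quat (qre q) (- qi q) (- qj q) (- qk q).

Definition S2 (R : realType) : set (quat R) :=
  [set q | qre q = 0 /\ `|q| = 1].

Definition Cplane (R : realType) (I : quat R) : set (quat R) :=
  [set q | exists x y : R, q = x%:A + y *: I].

Definition axially_symmetric (R : realType) (L : set (quat R)) : Prop :=
  forall q, L q -> forall I, S2 I -> L ((qre q)%:A + `|qvec q| *: I).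

Definition s_domain (R : realType) (L : set (quat R)) : Prop :=
  [/\ open L, connected L,
      L `&` range (fun x : R => x%:A) !=set0 &
      forall I, S2 I -> connected (L `&` Cplane I)].

(** A function on [L] is a Rocq function on the subtype [{x | x \in L}]. Its
    zero extension [qext] is only used to speak about derivatives at points of
    [L]: for [L] open these do not depend on the values outside [L]. *)
Definition qext (R : realType) (L : set (quat R)) (f : L -> quat R) :
  quat R -> quat R := 'valL_0 f.

Definition slice_dbar (R : realType) (f : quat R -> quat R) (I : quat R)
    (x y : R) : quat R :=
  derive1 (fun s : R => f (s%:A + y *: I)) x
    + I * derive1 (fun t : R => f (x%:A + t *: I)) y.

Definition SR (R : realType) (L : set (quat R)) : set (L -> quat R) :=
  [set f | (forall q, L q -> differentiable (qext f) q) /\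
           (forall I, S2 I -> forall x y : R, L (x%:A + y *: I) ->
              slice_dbar (qext f) I x y = 0)].

Arguments SR {R} L.

Definition SRc (R : realType) (L : set (quat R)) : set (L -> quat R) :=
  [set f | SR L f /\
           forall p q : L, val p = qconj (val q) -> f q = qconj (f p)].

Arguments SRc {R} L.

Definition SRc_mul (R : realType) (L : set (quat R)) (a : quat R) :
  set (L -> quat R) := [set (fun q => f q * a) | f in SRc L].

Arguments SRc_mul {R} L a.

Definition direct_sum_of (R : pzRingType) (E : lmodType R) (n : nat)
    (V : set E) (W : 'I_n -> set E) : Prop :=
  [/\ forall k, submod_closed [in W k],
      V = [set \sum_k w k | w in [set w : 'I_n -> E | forall k, W k (w k)]] &
      forall w w' : 'I_n -> E,
        (forall k, W k (w k)) -> (forall k, W k (w' k)) ->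
        \sum_k w k = \sum_k w' k -> forall k, w k = w' k].

(* Main.v *)
Require Import Defs.
From HB Require Import structures.
From mathcomp Require Import all_boot all_order all_algebra.
From mathcomp Require Import ring lra.
From mathcomp Require Import all_classical all_reals all_analysis.

(** The analytic core is a uniqueness theorem: a slice regular function that
    vanishes at the real points of the domain is zero ([SR_eq0]). Granted this,
    the decomposition is algebra.

    Existence. For the standard units [u = 1, i, j, k], the mean
    [F(q) = 1/4 sum_u u f(u^* q u) u^*] (the star is conjugation) is again slice
    regular, and at a real point it is the real part of [f] ([real_part]).
    A slice regular [h] that is real on the real axis has the C-property
    ([SRc_of_real]): on the slice of [I], [h] agrees with its Schwarz reflection,
    formed with the map [anti_slice] that anticommutes with multiplication by
    [I], because both are regular there and agree at the real points. If [e_k]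
    runs over the given basis, then [sum_k e_k^* x e_k = 4 Re x]
    ([frame_average]), whence [f = sum_k F_k e_k], where [F_k] is the mean
    attached to [f e_k^*].

    Directness. Elements of [SRc] are real at real points, so a relation
    [sum_k d_k e_k = 0] forces [d_k = 0] there by independence of the [e_k], and
    then everywhere by uniqueness.

    Uniqueness. On one slice, pairing a regular [g] with [v] and [I v] gives real
    functions [u], [w] of two real variables satisfying the Cauchy-Riemann
    equations ([slice_diff_holo]). Only differentiability at each point is
    assumed, so the bisection argument of Goursat is used to get a primitive
    [F = U + i W] of [u + i w] ([primitive]); then [|F|^2] has second
    derivatives. Zeros spread by a maximum principle: [log |F|^2] is subharmonic
    where [F] is not zero and [l / |z|^2] is strictly subharmonic, so
    [|F|^2 exp (l / |z|^2)] has no interior maximum with positive value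
    ([no_weighted_max]). When [F] vanishes near the origin this weight is
    harmless there, and for large [l] it shows that [F] vanishes on every disk
    centred at the origin in the domain ([zero_disk]). A pair that vanishes on
    the real axis stays holomorphic when it is replaced by zero in the lower half
    plane ([holo_upper]), so it vanishes on an open set; connectedness of the
    slice then gives the result ([slice_identity]). *)

Set Implicit Arguments.
Unset Strict Implicit.
Unset Printing Implicit Defensive.

Import Order.TTheory GRing.Theory Num.Theory.
Import numFieldNormedType.Exports.

Local Open Scope classical_set_scope.
Local Open Scope ring_scope.

(** * Pointwise holomorphic pairs and one-variable calculus *)

(** Stating differentiability with explicit bounds keeps the bisection argument
    and the gluing along a line free of limits in the plane. *)
Definition tdiff (R : realType) (u : R -> R -> R) (x y a b : R) :=
  forall e, 0 < e -> exists2 d, 0 < d & forall h k, `|h| < d -> `|k| < d ->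
    `|u (x + h) (y + k) - u x y - (a * h + b * k)| <= e * (`|h| + `|k|).

(** Here [a + i b] is the complex derivative of [u + i w]; the Cauchy-Riemann
    equations are built into the two gradients. *)
Definition holo (R : realType) (u w : R -> R -> R) (x y : R) :=
  exists a b, tdiff u x y a (- b) /\ tdiff w x y b a.

Lemma is_derive_eps (R : realType) (f : R -> R) (x a : R) :
  (forall e, 0 < e -> exists2 d, 0 < d & forall h, `|h| < d ->
     `|f (x + h) - f x - a * h| <= e * `|h|) -> is_derive x 1 f a.
Proof.
move=> H.
have cf : h^-1 *: (f (h *: 1 + x) - f x) @[h --> 0^'] --> a.
  apply/cvgrPdist_le => e e0; have [d d0 Hd] := H _ e0.
  exists d => //= h; rewrite /ball /= sub0r normrN => hd h0.
  have := Hd h hd; rewrite -ler_pdivrMr ?normr_gt0// -normf_div => le.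
  apply: le_trans le; rewrite distrC le_eqVlt; apply/orP; left.
  apply/eqP; congr (`|_|).
  rewrite [h *: 1]mulr1 (addrC h x) [LHS]/= -[_ *: _]/(_ * _); field.
  exact: h0.
apply: DeriveDef; first by apply/cvg_ex; exists a; exact: cf.
by apply: cvg_lim => //; exact: cf.
Qed.

Lemma is_derive_epsP (R : realType) (f : R -> R) (x a : R) : is_derive x 1 f a ->
  forall e, 0 < e -> exists2 d, 0 < d & forall h, `|h| < d ->
     `|f (x + h) - f x - a * h| <= e * `|h|.
Proof.
case=> df Df e e0.
have cf : h^-1 *: (f (h *: 1 + x) - f x) @[h --> 0^'] --> a.
  by rewrite -Df; exact: df.
move/cvgrPdist_le : cf => /(_ _ e0) [d /= d0 Hd]; exists d => // h hd.
have [->|h0] := eqVneq h 0; first by rewrite addr0 mulr0 subrr subr0 normr0 mulr0.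
have := Hd h; rewrite /ball /= sub0r normrN => /(_ hd h0).
rewrite -(ler_pM2r (_ : 0 < `|h|)) ?normr_gt0// -normrM => le.
apply: le_trans le; rewrite -normrN le_eqVlt; apply/orP; left; apply/eqP.
congr (`|_|); rewrite [h *: 1]mulr1 (addrC h x) -[_ *: _]/(_ * _); field.
exact: h0.
Qed.

Lemma mean_value (R : realType) (f f' : R -> R) (a b : R) : a < b ->
  (forall x, a <= x <= b -> is_derive x 1 f (f' x)) ->
  exists2 c, a <= c <= b & f b - f a = f' c * (b - a).
Proof.
move=> ab df; case: (@MVT_segment R f f' a b (ltW ab)).
- by move=> x; rewrite in_itv /= => /andP[ax xb]; apply: df; rewrite !ltW.
- apply: continuous_in_subspaceT => x; rewrite inE /= in_itv /= => xab.
  apply: differentiable_continuous; apply/derivable1_diffP.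
  by have [] := df x xab.
- by move=> c; rewrite in_itv /= => cab e; exists c.
Qed.

Lemma antiderivative (R : realType) (f : R -> R) (a b : R) :
  (forall x, a < x < b -> {for x, continuous f}) -> forall a' b', a < a' -> b' < b ->
  exists F : R -> R, forall x, a' < x < b' -> is_derive x 1 F (f x).
Proof.
move=> cf a' b' aa' bb'.
exists (fun x => (\int[lebesgue_measure]_(t in [set` `[a', x]]) (f t))%R).
move=> x /andP[ax xb].
have /andP[ax' xb'] : a < x < b by apply/andP; split; lra.
have [] := @continuous_FTC1_closed R f a' x b' xb _ ax (cf x _).
- apply: continuous_compact_integrable; first exact: segment_compact.
  apply: continuous_in_subspaceT => y; rewrite inE /= in_itv /= => /andP[y1 y2].
  by apply: cf; apply/andP; split; lra.
- by apply/andP; split.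
- by move=> d; rewrite derive1E => e; apply: DeriveDef.
Qed.

(** * Goursat's theorem *)

Lemma tdiff_dx (R : realType) (u : R -> R -> R) (x y a b : R) :
  tdiff u x y a b -> is_derive x 1 (u^~ y) a.
Proof.
move=> H; apply: is_derive_eps => e e0; have [d d0 Hd] := H e e0; exists d => // h hd.
by have := Hd h 0 hd; rewrite normr0 mulr0 !addr0; apply.
Qed.

Lemma tdiff_dy (R : realType) (u : R -> R -> R) (x y a b : R) :
  tdiff u x y a b -> is_derive y 1 (u x) b.
Proof.
move=> H; apply: is_derive_eps => e e0; have [d d0 Hd] := H e e0; exists d => // k kd.
by have := Hd 0 k; rewrite normr0 mulr0 !addr0 !add0r; apply.
Qed.

(** When [F y] is an antiderivative of [u] along the line of height [y] and [G x]
    one of [w] along the vertical line at [x], this is the integral of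
    [u dx - w dy] over the boundary of the rectangle. Antiderivatives make it
    additive by pure algebra. *)
Definition loop (R : realType) (F G : R -> R -> R) (a b c d : R) :=
  (F c b - F c a) - (F d b - F d a) - ((G b d - G b c) - (G a d - G a c)).

(** The mean value theorem turns opposite sides into two differences, in which
    the affine parts cancel thanks to the Cauchy-Riemann equations; only the
    remainders are left. *)
Lemma loop_le (R : realType) (u w F G : R -> R -> R) (a b c d x0 y0 p q e : R) :
  0 <= e -> a < b -> c < d -> a <= x0 <= b -> c <= y0 <= d ->
  (forall x y, a <= x <= b -> c <= y <= d ->
     is_derive x 1 (F y) (u x y) /\ is_derive y 1 (G x) (w x y)) ->
  (forall x y, a <= x <= b -> c <= y <= d ->
     `|u x y - u x0 y0 - (p * (x - x0) - q * (y - y0))|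
       <= e * (`|x - x0| + `|y - y0|) /\
     `|w x y - w x0 y0 - (q * (x - x0) + p * (y - y0))|
       <= e * (`|x - x0| + `|y - y0|)) ->
  `|loop F G a b c d| <= 2 * e * ((b - a) + (d - c)) ^+ 2.
Proof.
move=> e0 ab cd x0ab y0cd D E.
have caa : a <= a <= b by apply/andP; split; lra.
have cbb : a <= b <= b by apply/andP; split; lra.
have ccc : c <= c <= d by apply/andP; split; lra.
have cdd : c <= d <= d by apply/andP; split; lra.
have [|xi xiab exi] := @mean_value R (fun x => F c x - F d x)
    (fun x => u x c - u x d) a b ab.
  move=> x xab; have [D1 _] := D x c xab ccc; have [D2 _] := D x d xab cdd.
  exact: is_deriveB.
have [|eta etacd eeta] := @mean_value R (fun y => G b y - G a y)
    (fun y => w b y - w a y) c d cd.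
  move=> y ycd; have [_ D1] := D b y cbb ycd; have [_ D2] := D a y caa ycd.
  exact: is_deriveB.
have -> : loop F G a b c d =
    (u xi c - u xi d) * (b - a) - (w b eta - w a eta) * (d - c).
  by rewrite -exi -eeta /loop; ring.
set S := (b - a) + (d - c).
have S0 : 0 < S by rewrite /S; lra.
have near x y : a <= x <= b -> c <= y <= d -> e * (`|x - x0| + `|y - y0|) <= e * S.
  move=> xab ycd; apply: ler_wpM2l => //; rewrite /S.
  case/andP: xab => ? ?; case/andP: ycd => ? ?.
  case/andP: x0ab => ? ?; case/andP: y0cd => ? ?.
  by apply: lerD; rewrite ler_norml; apply/andP; split; lra.
have [/le_trans/(_ (near _ _ xiab ccc)) h1 _] := E xi c xiab ccc.
have [/le_trans/(_ (near _ _ xiab cdd)) h2 _] := E xi d xiab cdd.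
have [_ /le_trans/(_ (near _ _ cbb etacd)) h3] := E b eta cbb etacd.
have [_ /le_trans/(_ (near _ _ caa etacd)) h4] := E a eta caa etacd.
set k := e * S in h1 h2 h3 h4.
have k0 : 0 <= k by rewrite mulr_ge0// ltW.
have -> : 2 * e * S ^+ 2 = (2 * k) * (b - a) + (2 * k) * (d - c).
  by rewrite /k /S; ring.
have -> : (u xi c - u xi d) * (b - a) - (w b eta - w a eta) * (d - c) =
  (u xi c - u xi d - q * (d - c)) * (b - a) -
  (w b eta - w a eta - q * (b - a)) * (d - c) by ring.
apply: le_trans (ler_normB _ _) _; rewrite !normrM.
rewrite (ger0_norm (_ : 0 <= b - a)) ?(ger0_norm (_ : 0 <= d - c)); try lra.
rewrite ler_norml in h1; rewrite ler_norml in h2; rewrite ler_norml in h3.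
rewrite ler_norml in h4.
case/andP: h1 => ? ?; case/andP: h2 => ? ?; case/andP: h3 => ? ?; case/andP: h4 => ? ?.
apply: lerD; apply: ler_wpM2r; try lra.
  by rewrite ler_norml; apply/andP; split; lra.
by rewrite ler_norml; apply/andP; split; lra.
Qed.

(** The integral over a rectangle is the sum of those over its four quarters, so
    one quarter carries at least a quarter of it. *)
Lemma loop_quarter (R : realType) (F G : R -> R -> R) (a c W H : R) :
  exists2 p : R * R, (p.1 = a \/ p.1 = a + W / 2) /\ (p.2 = c \/ p.2 = c + H / 2) &
  `|loop F G a (a + W) c (c + H)| <=
    4 * `|loop F G p.1 (p.1 + W / 2) p.2 (p.2 + H / 2)|.
Proof.
apply: contrapT => /forall2NP N.
have N' x y : (x = a \/ x = a + W / 2) -> (y = c \/ y = c + H / 2) ->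
    4 * `|loop F G x (x + W / 2) y (y + H / 2)| < `|loop F G a (a + W) c (c + H)|.
  move=> hx hy; case: (N (x, y)) => /= [|/negP]; first by case; split.
  by rewrite -ltNge.
have n1 := N' _ _ (or_introl erefl) (or_introl erefl).
have n2 := N' _ _ (or_intror erefl) (or_introl erefl).
have n3 := N' _ _ (or_introl erefl) (or_intror erefl).
have n4 := N' _ _ (or_intror erefl) (or_intror erefl).
move: n1 n2 n3 n4.
have -> : a + W / 2 + W / 2 = a + W by field.
have -> : c + H / 2 + H / 2 = c + H by field.
set x1 := loop _ _ _ _ _ _; set x2 := loop _ _ _ _ _ _.
set x3 := loop _ _ _ _ _ _; set x4 := loop _ _ _ _ _ _.
set x5 := loop _ _ _ _ _ _.
have -> : x2 = x1 + x3 + x4 + x5 by rewrite /x1 /x2 /x3 /x4 /x5 /loop; ring.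
have := ler_normD (x1 + x3 + x4) x5; have := ler_normD (x1 + x3) x4.
have := ler_normD x1 x3; lra.
Qed.

Lemma nested_limit (R : realType) (x h : nat -> R) :
  (forall n, 0 <= h n) -> (forall n, x n <= x n.+1 /\ x n.+1 + h n.+1 <= x n + h n) ->
  exists z, forall n, x n <= z <= x n + h n.
Proof.
move=> h0 mono.
have mx m k : x m <= x (m + k)%N.
  by elim: k => [|k IH]; rewrite ?addn0// addnS; apply: le_trans IH _; case: (mono (m + k)%N).
have mh m k : x (m + k)%N + h (m + k)%N <= x m + h m.
  elim: k => [|k IH]; rewrite ?addn0// addnS; apply: le_trans IH.
  by case: (mono (m + k)%N).
have ub n m : x m <= x n + h n.
  have [nm|/ltnW mn] := leqP n m.
    by apply: le_trans (mh n (m - n)%N); rewrite subnKC// lerDl.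
  by apply: (le_trans (mx m (n - m)%N)); rewrite subnKC// lerDl.
exists (sup (range x)) => n; apply/andP; split.
  by apply: ub_le_sup; [exists (x 0%N + h 0%N) => _ [m _ <-]; exact: ub | exists n].
by apply: ge_sup; [exists (x 0%N), 0%N | move=> _ [m _ <-]; exact: ub].
Qed.

(** Repeated quartering produces rectangles shrinking to a point where the bound
    of [loop_le], of order [4 ^- n] times an arbitrarily small factor,
    contradicts the lower bound [T / 4 ^+ n]. *)
Lemma goursat (R : realType) (u w F G : R -> R -> R) (a b c d : R) :
  a < b -> c < d ->
  (forall x y, a <= x <= b -> c <= y <= d ->
     is_derive x 1 (F y) (u x y) /\ is_derive y 1 (G x) (w x y)) ->
  (forall x y, a <= x <= b -> c <= y <= d -> holo u w x y) ->
  loop F G a b c d = 0.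
Proof.
move=> ab cd D Hh; apply/eqP; apply: contrapT => /negP T0.
have {}T0 : 0 < `|loop F G a b c d| by rewrite normr_gt0.
set T := `|_| in T0.
pose W n := (b - a) / 2 ^+ n; pose H n := (d - c) / 2 ^+ n.
have WS n : W n.+1 = W n / 2 by rewrite /W exprSr invfM mulrA.
have HS n : H n.+1 = H n / 2 by rewrite /H exprSr invfM mulrA.
have e2 n : (0 : R) < 2 ^+ n by rewrite exprn_gt0.
have W0 n : 0 < W n by rewrite divr_gt0// subr_gt0.
have H0 n : 0 < H n by rewrite divr_gt0// subr_gt0.
pose good (s : nat * (R * R)) (t : R * R) :=
  ((t.1 = s.2.1 \/ t.1 = s.2.1 + W s.1 / 2) /\
   (t.2 = s.2.2 \/ t.2 = s.2.2 + H s.1 / 2)) /\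
  `|loop F G s.2.1 (s.2.1 + W s.1) s.2.2 (s.2.2 + H s.1)| <=
    4 * `|loop F G t.1 (t.1 + W s.1 / 2) t.2 (t.2 + H s.1 / 2)|.
have [next Hnext] : {next & forall s, good s (next s)}.
  apply: choice => -[n [x y]]; have [p hp1 hp2] := loop_quarter F G x y (W n) (H n).
  by exists p; split.
have [st [st0 step]] : exists st : nat -> R * R, st 0%N = (a, c) /\ forall n,
    (((st n.+1).1 = (st n).1 \/ (st n.+1).1 = (st n).1 + W n / 2) /\
     ((st n.+1).2 = (st n).2 \/ (st n.+1).2 = (st n).2 + H n / 2)) /\
    `|loop F G (st n).1 ((st n).1 + W n) (st n).2 ((st n).2 + H n)| <=
      4 * `|loop F G (st n.+1).1 ((st n.+1).1 + W n / 2)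
                     (st n.+1).2 ((st n.+1).2 + H n / 2)|.
  exists (fix st n := if n is m.+1 then next (m, st m) else (a, c)).
  by split=> // n; exact: Hnext (n, _).
have big n : T <= 4 ^+ n * `|loop F G (st n).1 ((st n).1 + W n) (st n).2 ((st n).2 + H n)|.
  elim: n => [|n IH].
    by rewrite expr0 mul1r /W /H expr0 !divr1 st0 /= !(addrC _ (_ - _)) !subrK.
  apply: le_trans IH _; rewrite exprSr -mulrA ler_wpM2l ?exprn_ge0//.
  by have [_] := step n; rewrite WS HS.
have [x0 Hx0] : exists z, forall n, (st n).1 <= z <= (st n).1 + W n.
  apply: nested_limit => [n|n]; first exact: ltW.
  have [[[]+ _] _] := step n; rewrite WS => ->;
    have := W0 n; split; lra.
have [y0 Hy0] : exists z, forall n, (st n).2 <= z <= (st n).2 + H n.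
  apply: nested_limit => [n|n]; first exact: ltW.
  have [[_ []+] _] := step n; rewrite HS => ->;
    have := H0 n; split; lra.
have inx n : a <= (st n).1 /\ (st n).1 + W n <= b.
  elim: n => [|n [i1 i2]]; first by rewrite /W expr0 st0 /=; lra.
  have [[[]+ _] _] := step n; rewrite WS => ->;
    have := W0 n; split; lra.
have iny n : c <= (st n).2 /\ (st n).2 + H n <= d.
  elim: n => [|n [i1 i2]]; first by rewrite /H expr0 st0 /=; lra.
  have [[_ []+] _] := step n; rewrite HS => ->;
    have := H0 n; split; lra.
have x0ab : a <= x0 <= b.
  by have := Hx0 0%N; have := inx 0%N => -[? ?] /andP[? ?]; apply/andP; split; lra.
have y0cd : c <= y0 <= d.
  by have := Hy0 0%N; have := iny 0%N => -[? ?] /andP[? ?]; apply/andP; split; lra.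
have [p [q [Du Dw]]] := Hh x0 y0 x0ab y0cd.
set S := (b - a) + (d - c).
have S0 : 0 < S by rewrite /S; lra.
(* With this tolerance the bound of [loop_le] is half the lower bound. *)
pose e := T / (4 * S ^+ 2).
have e0 : 0 < e by rewrite divr_gt0// mulr_gt0// exprn_gt0.
have [d1 d10 Hd1] := Du e e0; have [d2 d20 Hd2] := Dw e e0.
have [n [Wn Hn]] : exists n, (W n < Num.min d1 d2) /\ (H n < Num.min d1 d2).
  have [n hn] : exists n : nat, S / Num.min d1 d2 < n%:R.
    exists (Num.truncn (S / Num.min d1 d2)).+1.
    by rewrite truncnS_gt.
  have m0 : 0 < Num.min d1 d2 by rewrite lt_min d10.
  have n2 : (n%:R : R) < 2 ^+ n by rewrite -natrX ltr_nat ltn_expl.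
  have {}hn := lt_trans hn n2.
  rewrite ltr_pdivrMr// mulrC -ltr_pdivrMr// in hn.
  have /andP[ha hc] : (0 < b - a) && (0 < d - c) by apply/andP; split; lra.
  have i2 : 0 < (2 ^+ n)^-1 :> R by rewrite invr_gt0.
  exists n; split; apply: le_lt_trans hn; apply: ler_wpM2r; rewrite ?ltW// /S; lra.
have [ix1 ix2] := inx n; have [iy1 iy2] := iny n.
have sub x y : (st n).1 <= x <= (st n).1 + W n -> (st n).2 <= y <= (st n).2 + H n ->
   (a <= x <= b) /\ (c <= y <= d).
  by move=> /andP[? ?] /andP[? ?]; split; apply/andP; split; lra.
have le : `|loop F G (st n).1 ((st n).1 + W n) (st n).2 ((st n).2 + H n)|
    <= 2 * e * (S / 2 ^+ n) ^+ 2.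
  have -> : S / 2 ^+ n = (st n).1 + W n - (st n).1 + ((st n).2 + H n - (st n).2).
    by rewrite /W /H /S mulrDl; ring.
  apply: (@loop_le R u w F G _ _ _ _ x0 y0 p q); rewrite ?ltrDl ?(ltW e0)//.
    by move=> x y hx hy; have [hx' hy'] := sub _ _ hx hy; exact: D.
  move=> x y hx hy.
  have near1 : `|x - x0| < Num.min d1 d2.
    apply: le_lt_trans Wn; have := Hx0 n; case/andP: hx => ? ? /andP[? ?].
    by rewrite ler_norml; apply/andP; split; lra.
  have near2 : `|y - y0| < Num.min d1 d2.
    apply: le_lt_trans Hn; have := Hy0 n; case/andP: hy => ? ? /andP[? ?].
    by rewrite ler_norml; apply/andP; split; lra.
  move: near1 near2; rewrite !lt_min => /andP[n1 n2] /andP[n3 n4].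
  have := Hd1 _ _ n1 n3; have := Hd2 _ _ n2 n4.
  by rewrite !(addrC _ (_ - _)) !subrK mulNr.
have := big n; apply/negP; rewrite -ltNge.
apply: le_lt_trans (ler_wpM2l _ le) _; first by rewrite exprn_ge0.
have -> : 4 ^+ n * (2 * e * (S / 2 ^+ n) ^+ 2) = T / 2.
  rewrite expr_div_n -exprM mulnC exprM (_ : (2 : R) ^+ 2 = 4); last by ring.
  have f0 : (4%:R : R) ^+ n != 0 by rewrite expf_neq0.
  by rewrite /e; field; rewrite f0 /=; apply/eqP => S1; move: S0; rewrite S1; lra.
lra.
Qed.

(** * Primitives *)

Lemma is_derive_near (R : realType) (f g : R -> R) (x a d : R) : 0 < d ->
  (forall y : R, `|y - x| < d -> f y = g y) -> is_derive x 1 f a -> is_derive x 1 g a.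
Proof.
move=> d0 fg; apply: near_eq_is_derive; exists d => //= y.
by rewrite /ball /= distrC; exact: fg.
Qed.

Lemma is_derive_continuous (R : realType) (f : R -> R) (x a : R) :
  is_derive x 1 f a -> {for x, continuous f}.
Proof.
by case=> df _; apply: differentiable_continuous; apply/derivable1_diffP.
Qed.

Lemma goursat_box (R : realType) (u w F G : R -> R -> R) (r : R) :
  (forall x y : R, `|x| < r -> `|y| < r ->
     is_derive x 1 (F y) (u x y) /\ is_derive y 1 (G x) (w x y)) ->
  (forall x y : R, `|x| < r -> `|y| < r -> holo u w x y) ->
  forall a b c d, `|a| < r -> `|b| < r -> `|c| < r -> `|d| < r ->
  loop F G a b c d = 0.
Proof.
move=> D Hh.
have inb a b x : `|a| < r -> `|b| < r -> a <= x <= b -> `|x| < r.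
  by rewrite !ltr_norml => /andP[? ?] /andP[? ?] /andP[? ?]; apply/andP; split; lra.
have base a b c d : `|a| < r -> `|b| < r -> `|c| < r -> `|d| < r ->
    a < b -> c < d -> loop F G a b c d = 0.
  move=> ar br cr dr ab cd; apply: (goursat ab cd) => x y xab ycd.
    by apply: D; [exact: inb xab | exact: inb ycd].
  by apply: Hh; [exact: inb xab | exact: inb ycd].
have swapx a b c d : loop F G a b c d = - loop F G b a c d by rewrite /loop; ring.
have swapy a b c d : loop F G a b c d = - loop F G a b d c by rewrite /loop; ring.
have {}base a b c d : `|a| < r -> `|b| < r -> `|c| < r -> `|d| < r ->
    a < b -> loop F G a b c d = 0.
  move=> ar br cr dr ab; have [cd|dc|->] := ltgtP c d; first exact: base.
    by rewrite swapy base ?oppr0.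
  by rewrite /loop; ring.
move=> a b c d ar br cr dr; have [ab|ba|->] := ltgtP a b; first exact: base.
  by rewrite swapx base ?oppr0.
by rewrite /loop; ring.
Qed.

(** Integrating along the horizontal then the vertical side gives the vertical
    derivative at once; the horizontal one is read off the other path, which
    has the same integral because the loop vanishes. *)
Lemma primitive_re (R : realType) (u w : R -> R -> R) (r r' : R) :
  0 < r' -> r' < r ->
  (forall x y : R, `|x| < r -> `|y| < r -> holo u w x y) ->
  exists2 U : R -> R -> R, U 0 0 = 0 &
    forall x y : R, `|x| < r' -> `|y| < r' ->
      is_derive x 1 (U^~ y) (u x y) /\ is_derive y 1 (U x) (- w x y).
Proof.
move=> r'0 r'r Hh.
have anti (f : R -> R) : (forall t : R, `|t| < r -> exists l, is_derive t 1 f l) ->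
    exists F : R -> R, forall t : R, `|t| < r' -> is_derive t 1 F (f t).
  move=> df; have [|||F HF] := @antiderivative R f (- r) r _ (- r') r'.
  - move=> t; rewrite -ltr_norml => tr; have [l] := df t tr.
    exact: is_derive_continuous.
  - by rewrite ltrN2.
  - exact: r'r.
  - by exists F => t; rewrite ltr_norml; exact: HF.
have /choice[F HF] y : exists F, `|y| < r -> forall x, `|x| < r' ->
    is_derive (x : R) 1 (F : R -> R) (u x y).
  have [yr|yr] := ltP `|y| r; last by exists (cst 0).
  have [|F HF] := anti (u^~ y); last by exists F => _ x; exact: HF.
  by move=> x xr; have [a [b [Du _]]] := Hh x y xr yr; exists a; exact: tdiff_dx Du.
have /choice[G HG] x : exists G, `|x| < r -> forall y, `|y| < r' ->
    is_derive (y : R) 1 (G : R -> R) (w x y).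
  have [xr|xr] := ltP `|x| r; last by exists (cst 0).
  have [|G HG] := anti (w x); last by exists G => _ y; exact: HG.
  by move=> y yr; have [a [b [_ Dw]]] := Hh x y xr yr; exists a; exact: tdiff_dy Dw.
have r'_r (x : R) : `|x| < r' -> `|x| < r by move=> /lt_trans; exact.
have L0 x y : `|x| < r' -> `|y| < r' -> loop F G 0 x 0 y = 0.
  move=> xr yr; apply: (@goursat_box R u w F G r') => //; rewrite ?normr0//.
    by move=> s t sr tr; split; [apply: HF => //; exact: r'_r|apply: HG => //; exact: r'_r].
  by move=> s t sr tr; apply: Hh; exact: r'_r.
exists (fun x y => F 0 x - F 0 0 - (G x y - G x 0)); first by ring.
move=> x y xr yr; split; last first.
  have DG := HG x (r'_r _ xr) y yr.
  by apply: is_derive_eq; ring.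
pose U1 t : R := F y t - F y 0 - (G 0 y - G 0 0).
apply: (@is_derive_near R U1 _ x (u x y) (r' - `|x|)); first by rewrite subr_gt0.
  move=> z zx; have zr : `|z| < r'.
    by have := ler_normD (z - x) x; rewrite subrK; lra.
  have /eqP := L0 z y zr yr; rewrite /loop subr_eq0 subr_eq => /eqP e.
  rewrite /U1 e; ring.
have DF := HF y (r'_r _ yr) x xr.
by apply: is_derive_eq; ring.
Qed.

(** Multiplication by [- i], which turns the imaginary part of the primitive into
    a real part. *)
Lemma holoNi (R : realType) (u w : R -> R -> R) x y :
  holo u w x y -> holo w (fun x y => - u x y) x y.
Proof.
move=> [a [b [Du Dw]]]; exists b, (- a); rewrite opprK; split=> //.
move=> e e0; have [d d0 Hd] := Du e e0; exists d => // h k hd kd.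
apply: le_trans (Hd h k hd kd); rewrite -normrN le_eqVlt; apply/orP; left.
by apply/eqP; congr (`|_|); ring.
Qed.

Lemma primitive (R : realType) (u w : R -> R -> R) (r r' : R) :
  0 < r' -> r' < r ->
  (forall x y : R, `|x| < r -> `|y| < r -> holo u w x y) ->
  exists U W : R -> R -> R, [/\ U 0 0 = 0, W 0 0 = 0 &
    forall x y : R, `|x| < r' -> `|y| < r' ->
      [/\ is_derive x 1 (U^~ y) (u x y), is_derive y 1 (U x) (- w x y),
          is_derive x 1 (W^~ y) (w x y) & is_derive y 1 (W x) (u x y)]].
Proof.
move=> r'0 r'r Hh; have [U U0 HU] := primitive_re r'0 r'r Hh.
have [|W W0 HW] := @primitive_re R w (fun x y => - u x y) r r' r'0 r'r.
  by move=> x y xr yr; apply: holoNi; exact: Hh.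
exists U, W; split=> // x y xr yr; have [? ?] := HU x y xr yr.
by have [?] := HW x y xr yr; rewrite opprK.
Qed.

Lemma derive_bound (R : realType) (f f' : R -> R) (x y M : R) :
  (forall t : R, `|t - x| <= `|y - x| -> is_derive t 1 f (f' t) /\ `|f' t| <= M) ->
  `|f y - f x| <= M * `|y - x|.
Proof.
move=> H; have [xy|yx|->] := ltgtP x y; last by rewrite !subrr normr0 mulr0.
- have [|c cxy ->] := @mean_value R f f' x y xy.
    move=> t /andP[xt ty]; have [] // := H t.
    by rewrite !ger0_norm; lra.
  rewrite normrM ler_wpM2r//; have [] // := H c.
  by case/andP: cxy => ? ?; rewrite !ger0_norm; lra.
- have [|c cxy] := @mean_value R f f' y x yx.
    move=> t /andP[xt ty]; have [] // := H t.
    by rewrite !ler0_norm; lra.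
  rewrite distrC => ->; rewrite distrC normrM ler_wpM2r//; have [] // := H c.
  by case/andP: cxy => ? ?; rewrite !ler0_norm; lra.
Qed.

Lemma tdiff_bounded (R : realType) (u : R -> R -> R) (x y a b : R) :
  tdiff u x y a b -> exists M d, [/\ 0 < M, 0 < d & forall h k, `|h| < d -> `|k| < d ->
    `|u (x + h) (y + k)| <= M].
Proof.
move=> H; have [d d0 Hd] := H 1 ltr01.
exists (`|u x y| + `|a| + `|b| + 2), (Num.min d 1); split.
- by rewrite ltr_wpDl ?addr_ge0.
- by rewrite lt_min d0 ltr01.
move=> h k; rewrite !lt_min => /andP[hd h1] /andP[kd k1].
have := Hd h k hd kd; rewrite mul1r => le.
have ah : `|a * h| <= `|a| by rewrite normrM ler_piMr// ltW.
have bk : `|b * k| <= `|b| by rewrite normrM ler_piMr// ltW.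
set z := u (x + h) _ in le *; set l := a * h + b * k in le.
have := ler_normD (z - u x y - l) (u x y + l); have := ler_normD (u x y) l.
have := ler_normD (a * h) (b * k); rewrite -/l.
have -> : z - u x y - l + (u x y + l) = z by ring.
lra.
Qed.

Lemma continuous_of_partials (R : realType) (U u v : R -> R -> R) (r x y : R) (a b c d : R) :
  (forall x y : R, `|x| < r -> `|y| < r ->
     is_derive x 1 (U^~ y) (u x y) /\ is_derive y 1 (U x) (v x y)) ->
  tdiff u x y a b -> tdiff v x y c d -> `|x| < r -> `|y| < r ->
  {for (x, y), continuous (fun p : R * R => U p.1 p.2)}.
Proof.
move=> D /tdiff_bounded[M1 [d1 [M10 d10 H1]]] /tdiff_bounded[M2 [d2 [M20 d20 H2]]] xr yr.
apply/cvgrPdist_le => e e0 /=.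
pose de := Num.min (Num.min d1 d2) (Num.min (r - Num.max `|x| `|y|) (e / (M1 + M2))).
have de0 : 0 < de.
  by rewrite !lt_min d10 d20 subr_gt0 gt_max xr yr divr_gt0// addr_gt0.
exists (ball x de, ball y de); first by split; exists de.
move=> [x' y'] [/=]; rewrite /ball /= !(distrC _ x') !(distrC _ y').
rewrite !lt_min => /andP[/andP[xd1 xd2] /andP[xm xe]] /andP[/andP[yd1 yd2] /andP[ym ye]].
have mx : `|x| <= Num.max `|x| `|y| by rewrite le_max lexx.
have my : `|y| <= Num.max `|x| `|y| by rewrite le_max lexx orbT.
have x'r : `|x'| < r by have := ler_normD (x' - x) x; rewrite subrK; lra.
have hx : `|U x' y' - U x y'| <= M1 * `|x' - x|.
  apply: (@derive_bound _ (U^~ y') (u^~ y')) => t tx; split.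
    apply: (D t y' _ _).1.
      by have := ler_normD (t - x) x; rewrite subrK; lra.
    by have := ler_normD (y' - y) y; rewrite subrK; lra.
  by have := H1 (t - x) (y' - y); rewrite !(addrC _ (_ - _)) !subrK; apply=> //; lra.
have hy : `|U x y' - U x y| <= M2 * `|y' - y|.
  apply: (@derive_bound _ (U x) (v x)) => t tx; split.
    apply: (D x t _ _).2 => //.
    by have := ler_normD (t - y) y; rewrite subrK; lra.
  by have := H2 0 (t - y); rewrite normr0 addr0 (addrC y) subrK; apply=> //; lra.
rewrite distrC -[U x' y'](subrK (U x y')) -addrA.
apply: le_trans (ler_normD _ _) _; apply: le_trans (lerD hx hy) _.
have -> : e = M1 * (e / (M1 + M2)) + M2 * (e / (M1 + M2)).
  by field; apply/eqP; lra.
by apply: lerD; rewrite ler_pM2l// ltW.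
Qed.

(** * A weighted maximum principle *)

(** A positive [m] would make [f'] positive just to the right of [x], so that [f]
    would exceed its maximum there. *)
Lemma second_derivative_test (R : realType) (f f' : R -> R) (x m d : R) : 0 < d ->
  (forall t : R, `|t - x| < d -> is_derive t 1 f (f' t)) -> is_derive x 1 f' m ->
  (forall t : R, `|t - x| < d -> f t <= f x) -> f' x = 0 /\ m <= 0.
Proof.
move=> d0 df df' fmax.
have itv t : t \in `]x - d, x + d[ -> `|t - x| < d.
  by rewrite in_itv/= -ltr_distl.
have xx : `|x - x| < d by rewrite subrr normr0.
have f'x : f' x = 0.
  have [_ <-] := df x xx.
  have [||||_ ->//] := @derive1_at_max R f (x - d) (x + d) x.
  - lra.
  - by move=> t /itv tx; have [] := df t tx.
  - by rewrite in_itv /=; apply/andP; split; lra.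
  - by move=> t /itv; exact: fmax.
split=> //; rewrite leNgt; apply/negP => m0.
have [d1 d10 H] := is_derive_epsP df' (divr_gt0 m0 (ltr0n _ 2)).
pose h := Num.min d d1 / 2.
have h0 : 0 < h by rewrite divr_gt0// lt_min d0.
have hd : h < d.
  have : Num.min d d1 <= d by rewrite ge_min lexx.
  by rewrite /h; lra.
have hd1 : h < d1.
  have : Num.min d d1 <= d1 by rewrite ge_min lexx orbT.
  by rewrite /h; lra.
have pos t : 0 < t -> t <= h -> 0 < f' (x + t).
  move=> t0 th; have := H t; rewrite gtr0_norm// => /(_ (le_lt_trans th hd1)).
  rewrite f'x subr0 ler_norml => /andP[+ _].
  have : 0 < m / 2 * t by rewrite mulr_gt0// divr_gt0.
  have -> : m * t = m / 2 * t + m / 2 * t by field.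
  lra.
have near t : x <= t <= x + h -> `|t - x| < d.
  by move=> /andP[? ?]; rewrite ger0_norm; lra.
have lt1 : x < x + h / 2 by lra.
have lt2 : x + h / 2 < x + h by lra.
have [|c /andP[c1 c2] ec] := @mean_value R f f' x (x + h / 2) lt1.
  by move=> t /andP[? ?]; apply: df; apply: near; apply/andP; split; lra.
have [|c' /andP[c1' c2'] ec'] := @mean_value R f f' (x + h / 2) (x + h) lt2.
  by move=> t /andP[? ?]; apply: df; apply: near; apply/andP; split; lra.
have : f (x + h) <= f x by apply: fmax; apply: near; apply/andP; split; lra.
apply/negP; rewrite -ltNge -subr_gt0.
rewrite -(subrK (f (x + h / 2)) (f (x + h))) -addrA ec ec' ltr_pwDl//.
  rewrite mulr_gt0//; last lra.
  by rewrite -(subrK x c') addrC; apply: pos; lra.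
rewrite mulr_ge0//; last lra.
have [<-|cx] := eqVneq x c; first by rewrite f'x.
have {}cx : x < c by rewrite lt_neqAle cx.
by rewrite ltW// -(subrK x c) addrC; apply: pos; lra.
Qed.

Lemma is_derive_weight (R : realType) (l c t : R) : t ^+ 2 + c != 0 ->
  is_derive t 1 (fun t => expR (l / (t ^+ 2 + c)))
    (expR (l / (t ^+ 2 + c)) * (- 2 * l * t / (t ^+ 2 + c) ^+ 2)).
Proof.
move=> n0.
have D : is_derive t 1 (fun t => l / (t ^+ 2 + c)) (- 2 * l * t / (t ^+ 2 + c) ^+ 2).
  have D1 : is_derive t 1 (fun t => t ^+ 2 + c) (2 * t).
    by apply: is_derive_eq; rewrite /GRing.scale /=; ring.
  have D2 := @is_deriveV R (fun t => t ^+ 2 + c) t (2 * t) 1 n0 D1.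
  by apply: is_derive_eq; rewrite /GRing.scale /=; field.
exact: (@is_derive1_comp R expR (fun t => l / (t ^+ 2 + c)) t).
Qed.

Lemma is_derive_weight2 (R : realType) (l c t : R) : t ^+ 2 + c != 0 ->
  is_derive t 1 (fun t => - 2 * l * t / (t ^+ 2 + c) ^+ 2)
    (- 2 * l / (t ^+ 2 + c) ^+ 2 + 8 * l * t ^+ 2 / (t ^+ 2 + c) ^+ 3).
Proof.
move=> n0.
have D1 : is_derive t 1 (fun t => t ^+ 2 + c) (2 * t).
  by apply: is_derive_eq; rewrite /GRing.scale /=; ring.
have D2 : is_derive t 1 (fun t => (t ^+ 2 + c) ^+ 2) (4 * t * (t ^+ 2 + c)).
  by apply: is_derive_eq; rewrite /GRing.scale /=; ring.
have n1 : (t ^+ 2 + c) ^+ 2 != 0 by rewrite expf_neq0.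
have D3 := @is_deriveV R (fun t => (t ^+ 2 + c) ^+ 2) t _ 1 n1 D2.
by apply: is_derive_eq; rewrite /GRing.scale /=; field.
Qed.

(** In the conclusion, [psi1] and [psi2] are the derivatives of
    [psi = l / (t ^+ 2 + c)]; the two facts are the first and second order
    conditions for [(P ^+ 2 + Q ^+ 2) * expR psi], in which the first was used to
    remove the mixed term of the second. *)
Lemma weighted_max (R : realType) (P Q p q : R -> R) (al be l c x d : R) :
  0 < d -> 0 < x ^+ 2 + c ->
  (forall t : R, `|t - x| < d -> is_derive t 1 P (p t) /\ is_derive t 1 Q (q t)) ->
  is_derive x 1 p al -> is_derive x 1 q be ->
  (forall t : R, `|t - x| < d ->
     (P t ^+ 2 + Q t ^+ 2) * expR (l / (t ^+ 2 + c)) <=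
     (P x ^+ 2 + Q x ^+ 2) * expR (l / (x ^+ 2 + c))) ->
  let N := P x ^+ 2 + Q x ^+ 2 in
  let N1 := 2 * (P x * p x + Q x * q x) in
  let N2 := 2 * (p x ^+ 2 + q x ^+ 2 + P x * al + Q x * be) in
  let psi1 := - 2 * l * x / (x ^+ 2 + c) ^+ 2 in
  let psi2 := - 2 * l / (x ^+ 2 + c) ^+ 2 + 8 * l * x ^+ 2 / (x ^+ 2 + c) ^+ 3 in
  N1 = - N * psi1 /\ N2 - N * psi1 ^+ 2 + N * psi2 <= 0.
Proof.
move=> d0 xc0 D dp dq vmax N N1 N2 psi1 psi2.
pose del := Num.min d (Num.min 1 ((x ^+ 2 + c) / (2 * `|x| + 1))).
have k0 : 0 < 2 * `|x| + 1 by rewrite ltr_wpDl ?mulr_ge0.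
have del0 : 0 < del by rewrite !lt_min d0 ltr01 divr_gt0.
have nz t : `|t - x| < del -> t ^+ 2 + c != 0.
  rewrite !lt_min => /and3P[_ t1 t2].
  apply: lt0r_neq0; rewrite ltr_pdivlMr// in t2.
  have -> : t ^+ 2 + c = x ^+ 2 + c + (t - x) * (t + x) by ring.
  have : `|(t - x) * (t + x)| <= `|t - x| * (2 * `|x| + 1).
    rewrite normrM ler_wpM2l//.
    have := ler_normD (t - x) (x + x); have := ler_normD x x.
    have -> : t - x + (x + x) = t + x by ring.
    lra.
  by rewrite ler_norml => /andP[? _]; lra.
pose NN t := P t ^+ 2 + Q t ^+ 2.
pose NN1 t := 2 * (P t * p t + Q t * q t).
pose E t := expR (l / (t ^+ 2 + c)).
pose ps t := - 2 * l * t / (t ^+ 2 + c) ^+ 2.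
have sub t : `|t - x| < del -> `|t - x| < d by rewrite lt_min => /andP[].
have x0 : `|x - x| < del by rewrite subrr normr0.
have DN (t : R) : `|t - x| < del -> is_derive t 1 NN (NN1 t).
  move=> /sub/D[DP DQ].
  by apply: is_derive_eq; rewrite /GRing.scale /= /NN1; ring.
have DN1 : is_derive x 1 NN1 N2.
  have [DP DQ] := D x (sub _ x0).
  have -> : NN1 = (2 \*: ((P * p) + (Q * q))) by [].
  by apply: is_derive_eq; rewrite /GRing.scale /= /N2; ring.
have DE (t : R) : `|t - x| < del -> is_derive t 1 E (E t * ps t).
  by move=> /nz; exact: is_derive_weight.
have Dps : is_derive x 1 ps psi2 by apply: is_derive_weight2; exact: nz.
have [] := @second_derivative_test R (NN * E) ((NN1 + NN * ps) * E) x
   ((N2 + (N1 * psi1 + N * psi2)) * E x + (N1 + N * psi1) * (E x * psi1)) del del0.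
- move=> t tx; have d1 := DN t tx; have d2 := DE t tx.
  by apply: is_derive_eq; rewrite /GRing.scale /= !fctE; ring.
- have d1 := DN x x0; have d2 := DE x x0.
  by apply: is_derive_eq; rewrite /GRing.scale /= !fctE /NN1 /NN /N1 /N /ps /psi1; ring.
- by move=> t /sub; exact: vmax.
rewrite !fctE -/N1 -/N => /eqP; have E0 : 0 < E x by exact: expR_gt0.
rewrite mulf_eq0 (gt_eqF E0) orbF => /eqP e1 e2.
have {}e1 : N1 = - N * psi1.
  by apply/eqP; rewrite mulNr -addr_eq0; apply/eqP; exact: e1.
split=> //; move: e2.
have -> : (N2 + (N1 * psi1 + N * psi2)) * E x + (N1 + N * psi1) * (E x * psi1) =
  (N2 - N * psi1 ^+ 2 + N * psi2) * E x by rewrite e1; ring.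
by rewrite pmulr_lle0.
Qed.

(** Adding the second order conditions in both variables, the terms with the
    second derivatives of [U] and [W] cancel since these are harmonic. As
    [4 |f|^2 |F|^2] is the squared gradient of [N = |F|^2] when [f] is the
    derivative of [F], what remains is [N] times the Laplacian of [l / |z|^2],
    which is positive. *)
Lemma no_weighted_max (R : realType) (u w U W : R -> R -> R) (r l x y : R) :
  (forall x y : R, `|x| < r -> `|y| < r ->
      [/\ is_derive x 1 (U^~ y) (u x y), is_derive y 1 (U x) (- w x y),
          is_derive x 1 (W^~ y) (w x y) & is_derive y 1 (W x) (u x y)]) ->
  holo u w x y -> 0 < l -> 0 < x ^+ 2 + y ^+ 2 -> `|x| < r -> `|y| < r ->
  0 < U x y ^+ 2 + W x y ^+ 2 ->
  ~ (forall s t : R, `|s| < r -> `|t| < r ->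
     (U s t ^+ 2 + W s t ^+ 2) * expR (l / (s ^+ 2 + t ^+ 2)) <=
     (U x y ^+ 2 + W x y ^+ 2) * expR (l / (x ^+ 2 + y ^+ 2))).
Proof.
move=> D [a [b [Du Dw]]] l0 rho0 xr yr N0 vmax.
have nb (s z : R) : `|z| < r -> `|s - z| < r - `|z| -> `|s| < r.
  by move=> zr sz; have := ler_normD (s - z) z; rewrite subrK; lra.
have [||||||/=] := @weighted_max R (U^~ y) (W^~ y) (u^~ y) (w^~ y) a b l (y ^+ 2) x (r - `|x|).
- by rewrite subr_gt0.
- exact: rho0.
- by move=> t /nb tx; have [? _ ? _] := D t y (tx xr) yr.
- exact: tdiff_dx Du.
- exact: tdiff_dx Dw.
- by move=> t /nb tx; apply: vmax => //; exact: tx.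
move=> X1 X2.
have [||||||/=] := @weighted_max R (U x) (W x) (fun t => - w x t) (u x) (- a) (- b) l
    (x ^+ 2) y (r - `|y|).
- by rewrite subr_gt0.
- by rewrite addrC.
- by move=> t /nb ty; have [_ ? _ ?] := D x t xr (ty yr).
- have := tdiff_dy Dw; exact: is_deriveN.
- exact: tdiff_dy Du.
- by move=> t /nb ty; rewrite !(addrC _ (x ^+ 2)); apply: vmax => //; exact: ty.
rewrite !(addrC (y ^+ 2)).
move: X1 X2; set rho := x ^+ 2 + y ^+ 2 in rho0 *; set p := - 2 * l * x / _.
set q := - 2 * l * y / _.
set A := U x y in N0 *; set B := W x y in N0 *; set N := A ^+ 2 + _ in N0 *; set c := u x y; set d := w x y.
move=> X1 X2 Y1 Y2.
pose S := c ^+ 2 + d ^+ 2.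
have key : N * (4 * S) = N * (N * (p ^+ 2 + q ^+ 2)).
  have -> : N * (N * (p ^+ 2 + q ^+ 2)) = (- N * p) ^+ 2 + (- N * q) ^+ 2 by ring.
  by rewrite -X1 -Y1 /N /S; ring.
have {}key : 4 * S = N * (p ^+ 2 + q ^+ 2) by apply: (mulfI (lt0r_neq0 N0)).
have : 0 < N * (4 * l / rho ^+ 2) by rewrite mulr_gt0// divr_gt0 ?mulr_gt0 ?exprn_gt0.
have r0 := lt0r_neq0 rho0.
have -> : N * (4 * l / rho ^+ 2) =
  N * (- 2 * l / rho ^+ 2 + 8 * l * x ^+ 2 / rho ^+ 3) +
  N * (- 2 * l / rho ^+ 2 + 8 * l * y ^+ 2 / rho ^+ 3).
  have -> : x ^+ 2 = rho - y ^+ 2 by rewrite /rho; ring.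
  by field.
apply/negP; rewrite -leNgt; apply: le_trans (_ : _ <=
  (2 * (c ^+ 2 + d ^+ 2 + A * a + B * b) - N * p ^+ 2 +
   N * (- 2 * l / rho ^+ 2 + 8 * l * x ^+ 2 / rho ^+ 3)) +
  (2 * ((- d) ^+ 2 + c ^+ 2 + A * - a + B * - b) - N * q ^+ 2 +
   N * (- 2 * l / rho ^+ 2 + 8 * l * y ^+ 2 / rho ^+ 3))) _; last first.
  by rewrite -[leRHS]addr0; exact: lerD.
rewrite le_eqVlt; apply/orP; left; apply/eqP.
set k1 := _ / rho ^+ 2 + _; set k2 := _ / rho ^+ 2 + _.
have -> : 2 * (c ^+ 2 + d ^+ 2 + A * a + B * b) - N * p ^+ 2 + N * k1 +
  (2 * ((- d) ^+ 2 + c ^+ 2 + A * - a + B * - b) - N * q ^+ 2 + N * k2) =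
  4 * S - N * (p ^+ 2 + q ^+ 2) + (N * k1 + N * k2) by rewrite /S; ring.
by rewrite key subrr add0r.
Qed.

Lemma continuous_sqr (R : realType) (T : topologicalType) (f : T -> R) (p : T) :
  {for p, continuous f} -> {for p, continuous (fun p => f p ^+ 2)}.
Proof.
move=> cf; apply: (@continuous_comp _ _ _ f (fun x => x ^+ 2)) => //.
exact: exprn_continuous.
Qed.

Lemma continuous_expR_weight (R : realType) (l : R) (p : R * R) :
  p.1 ^+ 2 + p.2 ^+ 2 != 0 ->
  {for p, continuous (fun p : R * R => expR (l / (p.1 ^+ 2 + p.2 ^+ 2)))}.
Proof.
move=> n0; apply: (@continuous_comp _ _ _ (fun p : R * R => l / (p.1 ^+ 2 + p.2 ^+ 2)) expR).
  apply: cvgM; first exact: cvg_cst.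
  apply: cvgV => //; apply: cvgD; apply: continuous_sqr.
    exact: cvg_fst.
  exact: cvg_snd.
exact: continuous_expR.
Qed.

(** For [|F|^2 exp (l / |z|^2)] the maximum over a square lies neither near the
    origin, where [F = 0], nor in the interior, by [no_weighted_max]; so it lies
    at distance at least [R1] from the origin. A nonzero value of [F] closer to
    the origin than [R1] gains the exponentially larger weight, a contradiction
    for large [l]. *)
Lemma zero_disk (R : realType) (u w : R -> R -> R) (r s x1 y1 : R) :
  0 < s ->
  (forall x y : R, `|x| < r -> `|y| < r -> holo u w x y) ->
  (forall x y : R, `|x| < s -> `|y| < s -> u x y = 0 /\ w x y = 0) ->
  0 < r -> x1 ^+ 2 + y1 ^+ 2 < r ^+ 2 -> u x1 y1 = 0.
Proof.
move=> s0 Hh Z r0 in1.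
have [R1 [R10 R1r in1']] : exists R1, [/\ 0 < R1, R1 < r & x1 ^+ 2 + y1 ^+ 2 < R1 ^+ 2].
  exists ((Num.sqrt (x1 ^+ 2 + y1 ^+ 2) + r) / 2).
  have sq := sqrtr_ge0 (x1 ^+ 2 + y1 ^+ 2).
  have sr : Num.sqrt (x1 ^+ 2 + y1 ^+ 2) < r.
    by rewrite -(ger0_norm (ltW r0)) -sqrtr_sqr ltr_sqrt// exprn_gt0.
  split; [lra|lra|].
  rewrite -[ltLHS]sqr_sqrtr ?addr_ge0 ?sqr_ge0// ltr_sqr ?nnegrE//; lra.
pose r' := (R1 + r) / 2.
have R1r' : R1 < r' by rewrite /r'; lra.
have r'r : r' < r by rewrite /r'; lra.
have r'0 : 0 < r' by lra.
have inr' x y : x ^+ 2 + y ^+ 2 < R1 ^+ 2 -> `|x| < R1 /\ `|y| < R1.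
  move=> h; split; rewrite -ltr_sqr ?nnegrE ?(ltW R10)// real_normK ?num_real//.
    by apply: le_lt_trans h; rewrite lerDl sqr_ge0.
  by apply: le_lt_trans h; rewrite lerDr sqr_ge0.
have [U [W [U0 W0 D]]] := primitive r'0 r'r Hh.
have {s0} [s' [s'0 s'r' s's]] : exists s', [/\ 0 < s', s' < r' & s' <= s].
  exists (Num.min s (r' / 2)); rewrite lt_min s0 ge_min lexx; split=> //; first lra.
  by rewrite gt_min orbC; have -> : r' / 2 < r' by lra.
have {}Z x y : `|x| < s' -> `|y| < s' -> U x y = 0 /\ W x y = 0.
  move=> xs ys.
  have Z' (a b : R) : `|a| < s' -> `|b| < s' -> u a b = 0 /\ w a b = 0.
    by move=> as' bs; apply: Z; lra.
  have sr (t : R) : `|t| < s' -> `|t| < r' by lra.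
  have z0 : `|0 : R| < s' by rewrite normr0.
  have fl (f f' : R -> R) (z : R) : `|z| < s' ->
      (forall t : R, `|t| < s' -> is_derive t 1 f (f' t) /\ f' t = 0) -> f z = f 0.
    move=> zs df; have := @derive_bound R f f' 0 z 0.
    rewrite mul0r subr0 => h; apply/eqP; rewrite -subr_eq0 -normr_le0; apply: h => t.
    rewrite subr0 => /le_lt_trans/(_ zs)/df[dt et]; split; first exact: dt.
    by rewrite et normr0.
  split.
    have Ux : U x 0 = U 0 0.
      apply: (fl (U^~ 0) (u^~ 0)) => // t ts; split.
        by have [] := D t 0 (sr _ ts) (sr _ z0).
      by have [] := Z' t 0 ts z0.
    rewrite -[RHS]U0 -Ux; apply: (fl (U x) (fun t => - w x t)) => // t ts; split.
      by have [] := D x t (sr _ xs) (sr _ ts).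
    by have [_ ->] := Z' x t xs ts; rewrite oppr0.
  have Wx : W x 0 = W 0 0.
    apply: (fl (W^~ 0) (w^~ 0)) => // t ts; split.
      by have [] := D t 0 (sr _ ts) (sr _ z0).
    by have [] := Z' t 0 ts z0.
  rewrite -[RHS]W0 -Wx; apply: (fl (W x) (u x)) => // t ts; split.
    by have [] := D x t (sr _ xs) (sr _ ts).
  by have [] := Z' x t xs ts.
pose N (p : R * R) := U p.1 p.2 ^+ 2 + W p.1 p.2 ^+ 2.
have N_ge0 p : 0 <= N p by rewrite addr_ge0 ?sqr_ge0.
have cN (p : R * R) : `|p.1| < r' -> `|p.2| < r' -> {for p, continuous N}.
  case: p => x y /= xr yr.
  have [a [b [Du Dw]]] := Hh x y (lt_trans xr r'r) (lt_trans yr r'r).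
  have Dmw : tdiff (fun x y => - w x y) x y (- b) (- a).
    move=> e e0; have [d d0 Hd] := Dw e e0; exists d => // h k hd kd.
    apply: le_trans (Hd h k hd kd); rewrite -normrN le_eqVlt; apply/orP; left.
    by apply/eqP; congr (`|_|); ring.
  apply: cvgD; apply: continuous_sqr.
    apply: (@continuous_of_partials R U u (fun x y => - w x y) r' x y _ _ _ _ _ Du Dmw xr yr).
    by move=> x' y' x'r y'r; have [? ? _ _] := D x' y' x'r y'r.
  apply: (@continuous_of_partials R W w u r' x y _ _ _ _ _ Dw Du xr yr).
  by move=> x' y' x'r y'r; have [_ _ ? ?] := D x' y' x'r y'r.
suff Nz x y : x ^+ 2 + y ^+ 2 < R1 ^+ 2 -> U x y = 0.
  have [x1R y1R] := inr' _ _ in1'.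
  have [Dx _ _ _] := D x1 y1 (lt_trans x1R R1r') (lt_trans y1R R1r').
  have [d d0 Hd] : exists2 d, 0 < d & forall t : R, `|t - x1| < d -> 0 = U t y1.
    pose de := R1 ^+ 2 - (x1 ^+ 2 + y1 ^+ 2).
    have de0 : 0 < de by rewrite subr_gt0.
    pose k := 2 * `|x1| + 1.
    have k0 : 0 < k by rewrite ltr_wpDl ?mulr_ge0.
    exists (Num.min 1 (de / k)) => [|t]; first by rewrite lt_min ltr01 divr_gt0.
    rewrite lt_min ltr_pdivlMr// => /andP[t1 t2]; apply/esym/Nz.
    have -> : t ^+ 2 + y1 ^+ 2 = x1 ^+ 2 + y1 ^+ 2 + (t - x1) * (t + x1) by ring.
    have : (t - x1) * (t + x1) <= `|t - x1| * k.
      apply: le_trans (ler_norm _) _; rewrite normrM ler_wpM2l// /k.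
      have := ler_normD (t - x1) (x1 + x1); have := ler_normD x1 x1.
      have -> : t - x1 + (x1 + x1) = t + x1 by ring.
      lra.
    by move: t2; rewrite /de; lra.
  have := is_derive_near d0 Hd (is_derive_cst (0 : R) x1 1).
  by move: Dx => -[_ <-] [_ ->].
move=> in2.
have [x2R y2R] := inr' _ _ in2.
apply/eqP; apply: contrapT => /negP Un0.
pose p0 := (x, y).
have Np0 : 0 < N p0 by rewrite /N /= ltr_pwDl ?sqr_ge0// exprn_even_gt0.
pose K : set (R * R) := `[- R1, R1] `*` `[- R1, R1].
have inK p : p \in K -> `|p.1| <= R1 /\ `|p.2| <= R1.
  by rewrite inE /K => -[/=]; rewrite !in_itv/= -!ler_norml.
have Kin (p : R * R) : `|p.1| <= R1 -> `|p.2| <= R1 -> p \in K.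
  by move=> h1 h2; rewrite inE /K; split; rewrite /= in_itv/= -ler_norml.
have cK : compact K by apply: compact_setX; exact: segment_compact.
have K0 : K !=set0 by exists p0; apply/set_mem/Kin; exact: ltW.
have p0K : p0 \in K by apply: Kin; exact: ltW.
have [cm cmK Ncm] : exists2 c, c \in K & forall t, t \in K -> N t <= N c.
  apply: compact_EVT_max => //; apply: continuous_in_subspaceT => p /inK[h1 h2].
  by apply: cN; lra.
pose M := N cm.
have M0 : 0 < M by apply: lt_le_trans Np0 (Ncm _ p0K).
have rho_pos p : 0 < N p -> 0 < p.1 ^+ 2 + p.2 ^+ 2.
  move=> Np; rewrite lt_neqAle addr_ge0 ?sqr_ge0// andbT eq_sym.
  rewrite paddr_eq0 ?sqr_ge0// !sqrf_eq0; apply/negP => /andP[/eqP p1 /eqP p2].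
  have [e1 e2] : U p.1 p.2 = 0 /\ W p.1 p.2 = 0 by apply: Z; rewrite ?p1 ?p2 normr0.
  by move: Np; rewrite /N e1 e2 expr0n /= addr0 ltxx.
have rho0 := rho_pos _ Np0; rewrite /= in rho0.
pose del := (x ^+ 2 + y ^+ 2)^-1 - (R1 ^+ 2)^-1.
have del0 : 0 < del by rewrite subr_gt0 ltf_pV2 ?posrE ?exprn_gt0.
(* This makes the ratio of the weights at [p0] and on the circle of radius [R1]
   equal to [expR (M / N p0)], which exceeds [M / N p0]. *)
pose l := M / (N p0 * del).
have l0 : 0 < l by rewrite divr_gt0// mulr_gt0.
pose v (p : R * R) := N p * expR (l / (p.1 ^+ 2 + p.2 ^+ 2)).
have edge : M * expR (l / R1 ^+ 2) < v p0.
  rewrite /v /= -[l / (x ^+ 2 + _)](subrK (l / R1 ^+ 2)) expRD mulrA.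
  rewrite ltr_pM2r ?expR_gt0// -ltr_pdivrMl//.
  have -> : l / (x ^+ 2 + y ^+ 2) - l / R1 ^+ 2 = M / N p0.
    rewrite -mulrBr -/del /l; field; rewrite !lt0r_neq0//.
  rewrite mulrC; apply: lt_le_trans (expR_ge1Dx _); lra.
have cv : {within K, continuous v}.
  apply: continuous_in_subspaceT => p /inK[h1 h2].
  (* The weight is singular at the origin, but there it multiplies zero. *)
  have [p00|pn0] := eqVneq (p.1 ^+ 2 + p.2 ^+ 2) 0.
    move/eqP : p00; rewrite paddr_eq0 ?sqr_ge0// !sqrf_eq0 => /andP[/eqP p1 /eqP p2].
    apply: (@near_cst_continuous _ _ 0).
    exists (ball p.1 s', ball p.2 s'); first by split; exists s'.
    move=> [a b] [/=]; rewrite /ball /= p1 p2 !sub0r !normrN => a1 b1.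
    by rewrite /v /N /=; have [-> ->] := Z a b a1 b1; rewrite expr0n /= addr0 mul0r.
  apply: cvgM; first by apply: cN; lra.
  exact: continuous_expR_weight.
have [c cKc vc] := compact_EVT_max K0 cK cv.
have vc0 := vc _ p0K.
have Nc0 : 0 < N c.
  have : 0 < v c by apply: lt_le_trans vc0; rewrite mulr_gt0 ?expR_gt0.
  by rewrite pmulr_lgt0 ?expR_gt0.
have rhoc := rho_pos _ Nc0.
have [c1 c2] := inK _ cKc.
have outer : R1 ^+ 2 <= c.1 ^+ 2 + c.2 ^+ 2 -> False.
  move=> big; have : v c <= M * expR (l / R1 ^+ 2).
    apply: ler_pM; rewrite ?expR_ge0//; first exact: Ncm.
    by rewrite ler_expR ler_pM2l// lef_pV2 ?posrE ?exprn_gt0.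
  by move=> h; have := lt_le_trans edge (le_trans vc0 h); rewrite ltxx.
have c1' : `|c.1| < R1.
  rewrite lt_neqAle c1 andbT; apply/eqP => e; apply: outer.
  by rewrite -e real_normK ?num_real// lerDl sqr_ge0.
have c2' : `|c.2| < R1.
  rewrite lt_neqAle c2 andbT; apply/eqP => e; apply: outer.
  by rewrite -e real_normK ?num_real// lerDr sqr_ge0.
apply: (@no_weighted_max R u w U W R1 l c.1 c.2) => //.
- by move=> a b a1 b1; apply: D; lra.
- by apply: Hh; lra.
- by move=> a b a1 b1; apply: (vc (a, b)); apply: Kin; rewrite /= ltW.
Qed.

(** * Zeros on a line *)

Definition upper_part (R : realType) (u : R -> R -> R) (x y : R) :=
  if 0 < y then u x y else 0.

Lemma tdiff_upper_gt0 (R : realType) (u : R -> R -> R) (x y a b : R) :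
  0 < y -> tdiff u x y a b -> tdiff (upper_part u) x y a b.
Proof.
move=> y0 Du e e0; have [d d0 Hd] := Du e e0.
exists (Num.min d y) => [|h k]; first by rewrite lt_min d0.
rewrite !lt_min => /andP[hd _] /andP[kd]; rewrite ltr_norml => /andP[k1 _].
by rewrite /upper_part y0 (_ : 0 < y + k); [exact: Hd | lra].
Qed.

Lemma tdiff_upper_lt0 (R : realType) (u : R -> R -> R) (x y : R) :
  y < 0 -> tdiff (upper_part u) x y 0 0.
Proof.
move=> y0 e e0; exists (- y) => [|h k _]; first lra.
rewrite ltr_norml => /andP[_ k1].
rewrite /upper_part !ifF; [|by apply/negbTE; rewrite -leNgt; lra..].
by rewrite !mul0r addr0 !subr0 normr0 mulr_ge0 ?addr_ge0// ltW.
Qed.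

Lemma tdiff_upper_eq0 (R : realType) (u : R -> R -> R) (x : R) :
  u x 0 = 0 -> tdiff u x 0 0 0 -> tdiff (upper_part u) x 0 0 0.
Proof.
move=> u0 Du e e0; have [d d0 Hd] := Du e e0; exists d => // h k hd kd.
have := Hd h k hd kd; rewrite u0 /upper_part ltxx add0r /=; case: ifP => // _ _.
by rewrite !mul0r addr0 !subr0 normr0 mulr_ge0 ?addr_ge0// ltW.
Qed.

(** On the axis both derivatives along the axis vanish, hence by the
    Cauchy-Riemann equations so does the whole differential: the two halves
    match to first order. *)
Lemma holo_upper (R : realType) (u w : R -> R -> R) (r x y : R) :
  (forall x y : R, `|x| < r -> `|y| < r -> holo u w x y) ->
  (forall x : R, `|x| < r -> u x 0 = 0 /\ w x 0 = 0) ->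
  `|x| < r -> y < r -> holo (upper_part u) (upper_part w) x y.
Proof.
move=> Hh Z xr yr; have [y0|y0|->] := ltgtP y 0.
- by exists 0, 0; rewrite oppr0; split; exact: tdiff_upper_lt0.
- have [|a [b [Du Dw]]] := Hh x y xr; first by rewrite gtr0_norm.
  by exists a, b; split; exact: tdiff_upper_gt0.
have [|a [b [Du Dw]]] := Hh x 0 xr.
  by rewrite normr0; apply: le_lt_trans xr.
have flat (f : R -> R) l : (forall t : R, `|t| < r -> f t = 0) -> is_derive x 1 f l -> l = 0.
  move=> f0 [_ <-]; have rx : 0 < r - `|x| by rewrite subr_gt0.
  have [] // := @is_derive_near R (cst 0) f x 0 (r - `|x|) rx _ (is_derive_cst _ _ _).
  by move=> t tx; rewrite f0//; have := ler_normD (t - x) x; rewrite subrK; lra.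
have a0 : a = 0 by apply: flat (tdiff_dx Du) => t /Z[].
have b0 : b = 0 by apply: flat (tdiff_dx Dw) => t /Z[].
have [ux wx] := Z x xr; rewrite a0 b0 oppr0 in Du Dw.
by exists 0, 0; rewrite oppr0; split; exact: tdiff_upper_eq0.
Qed.

(** The pair cut off below the axis vanishes near the point [(0, - r / 3)], and
    the disk of radius [2 * r / 3] about it stays in the square while covering
    the asserted region. *)
Lemma zero_half (R : realType) (u w : R -> R -> R) (r x y : R) :
  (forall x y : R, `|x| < r -> `|y| < r -> holo u w x y) ->
  (forall x : R, `|x| < r -> u x 0 = 0 /\ w x 0 = 0) ->
  `|x| < r / 4 -> 0 < y < r / 4 -> u x y = 0.
Proof.
move=> Hh Z xr /andP[y0 yr].
have r0 : 0 < r by lra.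
pose sh (f : R -> R -> R) x y := upper_part f x (y - r / 3).
have := @zero_disk R (sh u) (sh w) (2 * r / 3) (r / 3) x (y + r / 3).
rewrite /sh addrK /upper_part y0; apply; last 2 first.
- lra.
- move: xr; rewrite ltr_norml => /andP[? ?].
  have : 0 <= (r / 4 - x) * (r / 4 + x) by rewrite mulr_ge0; lra.
  have : 0 <= (r / 4 - y) * (y + r / 4 + 2 * r / 3) by rewrite mulr_ge0; lra.
  have : 0 < r * r by rewrite mulr_gt0.
  have -> : x ^+ 2 = x * x by []. 
  have -> : (y + r / 3) ^+ 2 = y * y + 2 / 3 * (r * y) + (r * r) / 9 by field.
  have -> : (2 * r / 3) ^+ 2 = (r * r) * 4 / 9 by field.
  have -> : (r / 4 - x) * (r / 4 + x) = (r * r) / 16 - x * x by field.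
  have -> : (r / 4 - y) * (y + r / 4 + 2 * r / 3) =
      r * r * 11 / 48 - (r * y) * 2 / 3 - y * y by field.
  lra.
- lra.
- move=> x' y'; rewrite !ltr_norml => /andP[? ?] /andP[? ?].
  have [||a [b [Da Db]]] := @holo_upper R u w r x' (y' - r / 3) Hh Z.
  - by rewrite ltr_norml; apply/andP; split; lra.
  - lra.
  exists a, b; split=> e e0.
    have [d d0 Hd] := Da e e0; exists d => // h k hd kd.
    by rewrite -(addrAC y'); exact: Hd.
  have [d d0 Hd] := Db e e0; exists d => // h k hd kd.
  by rewrite -(addrAC y'); exact: Hd.
- move=> x' y' _; rewrite ltr_norml => /andP[_ y1].
  have -> // : (0 < y' - r / 3) = false.
  by apply/negbTE; rewrite -leNgt; lra.
Qed.

(** * Quaternion algebra and slice regular functions *)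

Section quaternion_algebra.
Variable R : realType.
Implicit Types p q u v I : quat R.

Lemma quat_realE (x : R) : x%:A = Quat x 0 0 0 :> quat R.
Proof. by apply: quat_eqP => /=; rewrite ?mulr1 ?mulr0. Qed.

Lemma normqM p q : `|p * q| = `|p| * `|q|.
Proof.
rewrite !quat_normE -sqrtrM ?qdot_ge0//; congr Num.sqrt.
by case: p => ????; case: q => ????; rewrite /qdot /=; ring.
Qed.

Lemma normq_conj q : `|qconj q| = `|q|.
Proof.
by rewrite !quat_normE; congr Num.sqrt; rewrite /qdot /=; ring.
Qed.

Lemma qconjM p q : qconj (p * q) = qconj q * qconj p.
Proof. by apply: quat_eqP => /=; ring. Qed.

Lemma qconjK : involutive (@qconj R).
Proof. by move=> q; apply: quat_eqP => /=; rewrite ?opprK. Qed.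

Lemma qconj_re0 q : qre q = 0 -> qconj q = - q.
Proof. by move=> q0; apply: quat_eqP => /=; rewrite ?q0 ?oppr0. Qed.

Lemma S2P I : S2 I -> qre I = 0 /\ qdot I I = 1.
Proof. by case=> r0 n1; split=> //; rewrite -Defs.sqr_normq -[Defs.normq I]/(`|I|) n1 expr1n. Qed.

Lemma S2_sqr I : S2 I -> I * I = -1.
Proof.
case/S2P; case: I => a b c d; rewrite /qdot /= => -> n1.
by apply: quat_eqP => /=; [rewrite -n1; ring | ring | ring | ring].
Qed.

Lemma S2_opp I : S2 I -> S2 (- I).
Proof. by case=> r0 n1; split; rewrite ?normrN//= r0 oppr0. Qed.

Lemma S2_qi : S2 (Quat 0 1 0 0 : quat R).
Proof.
split=> //; rewrite quat_normE /qdot /= !mulr0 !addr0 add0r mulr1; exact: sqrtr1.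
Qed.

Lemma normq_slice I (x y : R) : S2 I -> `|x%:A + y *: I| ^+ 2 = x ^+ 2 + y ^+ 2.
Proof.
move=> /S2P[r0 n1]; rewrite -[`|_|]/(Defs.normq _) Defs.sqr_normq quat_realE.
move: r0 n1; case: I => a b c d; rewrite /qdot /= => -> n1.
by rewrite -[y ^+ 2]mulr1 -n1; ring.
Qed.

Lemma quat_slice q : exists2 I, S2 I & q = (qre q)%:A + `|qvec q| *: I.
Proof.
have [q0|q0] := eqVneq `|qvec q| 0.
  exists (Quat 0 1 0 0); first exact: S2_qi.
  have /eqP := q0; rewrite normr_eq0 => /eqP[e1 e2 e3].
  rewrite q0 scale0r addr0 quat_realE.
  by apply: quat_eqP => //=; rewrite ?e1 ?e2 ?e3.
exists (`|qvec q|^-1 *: qvec q).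
  split; first by rewrite /= mulr0.
  by rewrite normrZ normfV normr_id mulVf.
rewrite scalerA divff// scale1r quat_realE.
by apply: quat_eqP => /=; rewrite ?addr0 ?add0r.
Qed.

End quaternion_algebra.

Section linear_maps.
Variable R : realType.

(** One bilinear shape covers right multiplication and rotations, so that
    linearity and continuity are established once. *)
Definition sandwich (u v q : quat R) := u * q * v.

Lemma sandwich_linear u v : linear (sandwich u v).
Proof. by move=> a p q; rewrite /sandwich mulrDr mulrDl -scalerAr -scalerAl. Qed.

HB.instance Definition _ (u v : quat R) :=
  GRing.isLinear.Build R (quat R) (quat R) _ (sandwich u v) (sandwich_linear u v).

Lemma qconj_linear : linear (@qconj R).
Proof. by move=> a p q; apply: quat_eqP => /=; ring. Qed.

HB.instance Definition _ :=
  GRing.isLinear.Build R (quat R) (quat R) _ (@qconj R) qconj_linear.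

Lemma bounded_continuous (A : {linear quat R -> quat R}) (M : R) :
  (forall q, `|A q| <= M * `|q|) -> continuous A.
Proof.
move=> AM; apply: bounded_linear_continuous; apply/linear_boundedP.
exists `|M|; split; first exact: normr_real.
move=> r Mr q; apply: le_trans (AM q) _; apply: ler_wpM2r => //.
by apply: le_trans (ler_norm _) _; exact: ltW.
Qed.

Lemma sandwich_continuous u v : continuous (sandwich u v).
Proof.
apply: (@bounded_continuous (sandwich u v) (`|u| * `|v|)) => q.
by rewrite /sandwich !normqM mulrAC.
Qed.

Lemma qconj_continuous : continuous (@qconj R).
Proof. by apply: (@bounded_continuous (@qconj R) 1) => q; rewrite normq_conj mul1r. Qed.

Lemma is_diff_linear (A : {linear quat R -> quat R}) q :
  continuous A -> is_diff q A A.
Proof. by move=> cA; apply: DiffDef; [exact: linear_differentiable|exact: diff_lin]. Qed.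

End linear_maps.

Section zero_extension.
Variables (R : realType) (L : set (quat R)).

Lemma qext_in (f : L -> quat R) (q : L) : qext f (val q) = f q.
Proof. by have /(congr1 (@^~ q)) := valLK 0 f. Qed.

Lemma qext_out (f : L -> quat R) q : ~ L q -> qext f q = 0.
Proof.
by move=> Lq; rewrite /qext /valL_ /= oinv_set_val insubN// notin_setE.
Qed.

Lemma qextE (f : L -> quat R) (h : quat R -> quat R) :
  (forall q : L, f q = h (val q)) -> (forall q, ~ L q -> h q = 0) -> qext f = h.
Proof.
move=> fh h0; apply/funext => q; have [Lq|Lq] := pselect (L q).
  by rewrite -[q]/(val (SigSub (mem_set Lq))) qext_in fh.
by rewrite qext_out// h0.
Qed.

End zero_extension.

(** The differential at [q] need only be complex linear from the slice of [I];
    this is the form of the regularity condition that survives composition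
    with linear maps. *)
Definition slice_diff (R : realType) (g : quat R -> quat R) (I q : quat R) :=
  exists2 D, is_diff q g D & D I = I * D 1.

Section slice_regular.
Variables (R : realType) (L : set (quat R)).

Lemma derive1_line (g : quat R -> quat R) (c : R -> quat R) (v a : quat R) (z : R) :
  (forall h, c (h + z) = h *: v + a) -> derive1 (g \o c) z = 'D_v g a.
Proof.
move=> Hc; rewrite /derive1 /derive.
have -> : (fun h => h^-1 *: ((g \o c) (h + z) - (g \o c) z)) =
          (fun h => h^-1 *: ((g \o shift a) (h *: v) - g a)).
  apply/funext => h /=; rewrite Hc; congr (_ *: (_ - g _)).
  by rewrite -[z]add0r Hc scale0r add0r.
by [].
Qed.

Lemma slice_dbarE (g : quat R -> quat R) (I : quat R) (x y : R) :
  differentiable g (x%:A + y *: I) ->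
  slice_dbar g I x y = 'd g (x%:A + y *: I) 1 + I * 'd g (x%:A + y *: I) I.
Proof.
move=> dg; rewrite /slice_dbar -(deriveE (1 : quat R) dg) -(deriveE I dg); congr (_ + I * _).
  by apply: derive1_line => h; rewrite addrA scalerDl.
by apply: derive1_line => h; rewrite addrCA scalerDl.
Qed.

Lemma dbar_eq0 (I a b : quat R) : S2 I -> a + I * b = 0 <-> b = I * a.
Proof.
move=> /S2_sqr I2; split=> [/eqP|->]; last by rewrite mulrA I2 mulN1r subrr.
by rewrite addr_eq0 => /eqP ->; rewrite mulrN mulrA I2 mulN1r opprK.
Qed.

Lemma SRP (f : L -> quat R) :
  SR L f <-> (forall q, L q -> differentiable (qext f) q) /\
    (forall I, S2 I -> forall x y : R, L (x%:A + y *: I) ->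
       'd (qext f) (x%:A + y *: I) I = I * 'd (qext f) (x%:A + y *: I) 1).
Proof.
split=> -[df H]; split=> // I SI x y Lxy.
  apply: (dbar_eq0 _ _ SI).1; rewrite -slice_dbarE; [exact: H|exact: df].
by rewrite slice_dbarE; [apply: (dbar_eq0 _ _ SI).2; exact: H|exact: df].
Qed.

Lemma SR_slice_diff (f : L -> quat R) (I : quat R) (x y : R) :
  SR L f -> S2 I -> L (x%:A + y *: I) -> slice_diff (qext f) I (x%:A + y *: I).
Proof.
move=> /SRP[df H] SI Lxy; exists ('d (qext f) (x%:A + y *: I)); last exact: H.
by apply: DiffDef => //; exact: df.
Qed.

Lemma slice_diff_SR (f : L -> quat R) :
  (forall I (x y : R), S2 I -> L (x%:A + y *: I) ->
     slice_diff (qext f) I (x%:A + y *: I)) -> SR L f.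
Proof.
move=> H; apply/SRP; split=> [q Lq|I SI x y Lxy].
  have [I SI eq] := quat_slice q; rewrite eq in Lq.
  by have [D [dq _] _] := H I _ _ SI Lq; rewrite eq.
by have [D [dq ->]] := H I _ _ SI Lxy.
Qed.

(** The inner map may move the slice of [I] to another one; the outer map must
    undo this on the left. *)
Lemma slice_diff_comp (g : quat R -> quat R) (A B : {linear quat R -> quat R}) I q :
  continuous A -> continuous B -> B 1 = 1 -> slice_diff g (B I) (B q) ->
  (forall z, A (B I * z) = I * A z) ->
  slice_diff (A \o g \o B) I q.
Proof.
move=> cA cB B1 [D dD DI] AI; exists (A \o D \o B); last first.
  by rewrite /= DI AI B1.
have dB := is_diff_linear q cB; have dA := is_diff_linear (g (B q)) cA.
exact: is_diff_comp.
Qed.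

Lemma slice_diffD (g h : quat R -> quat R) I q :
  slice_diff g I q -> slice_diff h I q -> slice_diff (g + h) I q.
Proof.
move=> [D dD DI] [D' dD' DI']; exists (D + D'); first exact: is_diffD.
by rewrite !fctE DI DI' mulrDr.
Qed.

Lemma slice_diffZ (a : R) (g : quat R -> quat R) I q :
  slice_diff g I q -> slice_diff (a *: g) I q.
Proof.
move=> [D dD DI]; exists (a *: D); first exact: is_diffZ.
by rewrite !fctE DI scalerAr.
Qed.

Lemma SR_lin (a : R) (f g : L -> quat R) : SR L f -> SR L g -> SR L (a *: f + g).
Proof.
move=> Sf Sg; apply: slice_diff_SR => I x y SI Lxy.
rewrite (@qextE _ _ _ (a *: qext f + qext g)).
- by apply: slice_diffD; [apply: slice_diffZ|]; exact: SR_slice_diff.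
- by move=> q; rewrite !fctE !qext_in.
- by move=> q Lq; rewrite !fctE !qext_out// scaler0 addr0.
Qed.

Lemma SR0 : SR L 0.
Proof.
apply: slice_diff_SR => I x y SI Lxy; rewrite (@qextE _ _ _ 0)//.
exists 0; last by rewrite mulr0.
exact: is_diff_cst.
Qed.

Lemma SR_mulr (f : L -> quat R) (a : quat R) : SR L f -> SR L (fun q => f q * a).
Proof.
move=> Sf; apply: slice_diff_SR => I x y SI Lxy.
rewrite (@qextE _ _ _ (sandwich 1 a \o qext f \o idfun)).
- apply: slice_diff_comp => //=.
  + exact: sandwich_continuous.
  + by move=> ?.
  + exact: SR_slice_diff.
  + by move=> z; rewrite /sandwich !mul1r mulrA.
- by move=> q /=; rewrite qext_in /sandwich mul1r.
- by move=> q Lq /=; rewrite qext_out// /sandwich mulr0 mul0r.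
Qed.

(** A rotation carries the slice of [I] to the slice of [v * I * u], and the outer
    conjugation carries left multiplication by that unit back to [I]. *)
Lemma SR_conjugate (f : L -> quat R) (u v : quat R) :
  u * v = 1 -> v * u = 1 -> (forall I, S2 I -> S2 (v * I * u)) ->
  (forall q, L (v * q * u) <-> L q) -> SR L f ->
  SR L (fun q => u * qext f (v * val q * u) * v).
Proof.
move=> uv vu S2u Lu Sf; apply: slice_diff_SR => I x y SI Lxy.
have rot : v * (x%:A + y *: I) * u = x%:A + y *: (v * I * u).
  rewrite mulrDr mulrDl -!scalerAr -!scalerAl mulr1 vu.
  by [].
rewrite (@qextE _ _ _ (sandwich u v \o qext f \o sandwich v u)).
- apply: slice_diff_comp => //=.
  + exact: sandwich_continuous.
  + exact: sandwich_continuous.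
  + by rewrite /sandwich mulr1.
  + rewrite /sandwich rot; apply: SR_slice_diff => //; first exact: S2u.
    by rewrite -rot; apply/Lu.
  + by move=> z; rewrite /sandwich !mulrA uv mul1r.
- by [].
- by move=> q Lq /=; rewrite qext_out ?/sandwich ?mulr0 ?mul0r// => /Lu.
Qed.

End slice_regular.

(** * The identity theorem on a slice *)

Section slice_identity.
Variables (R : realType) (I : quat R).
Hypothesis SI : S2 I.

Definition chart (q : quat R) (x y : R) : quat R := q + (x%:A + y *: I).

Lemma chartD q x y h k : chart q (x + h) (y + k) = chart q x y + (h%:A + k *: I).
Proof. by rewrite /chart !scalerDl -!addrA; do 2 congr (_ + _); rewrite addrCA. Qed.

Lemma qdotDl (p q v : quat R) : qdot (p + q) v = qdot p v + qdot q v.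
Proof. by rewrite /qdot /=; ring. Qed.

Lemma qdotZl a (p v : quat R) : qdot (a *: p) v = a * qdot p v.
Proof. by rewrite /qdot /=; ring. Qed.

Lemma qdotNl (p v : quat R) : qdot (- p) v = - qdot p v.
Proof. by rewrite /qdot /=; ring. Qed.

Lemma qdot_mulI (p v : quat R) : qdot (I * p) v = - qdot p (I * v).
Proof.
have [] := S2P SI; case: I => a b c d /= r0 _.
by rewrite /qdot /= r0; ring.
Qed.

Lemma qdot_normr_le (p v : quat R) : `|qdot p v| <= `|p| * `|v|.
Proof.
rewrite ler_norml -[`|p|]/(Defs.normq p) -[`|v|]/(Defs.normq v) qdot_le andbT.
rewrite lerNl -qdotNl; apply: le_trans (qdot_le _ _) _.
by rewrite -[Defs.normq _]/(`|- p|) normrN.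
Qed.

Lemma quat_nbhsP (q : quat R) (A : set (quat R)) :
  nbhs q A <-> exists2 r : R, 0 < r & forall p, `|p - q| < r -> A p.
Proof.
split=> [/nbhs_normP[r /= r0 Hr]|[r r0 Hr]].
  by exists r => // p pq; apply: Hr; rewrite /= distrC.
by apply/nbhs_normP; exists r => //= p /=; rewrite distrC; exact: Hr.
Qed.

Lemma is_diff_eps (g D : quat R -> quat R) q : is_diff q g D ->
  forall e, 0 < e -> exists2 d, 0 < d & forall h : quat R, `|h| < d ->
    `|g (q + h) - g q - D h| <= e * `|h|.
Proof.
move=> [dg <-] e e0.
have /eqaddoP/(_ _ e0) := diff_locally dg.
move=> /quat_nbhsP[d d0 Hd]; exists d => // h hd.
have := Hd h; rewrite subr0 => /(_ hd).
by rewrite /= !fctE /= (addrC h q) opprD addrA.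
Qed.

Lemma normq_chart_le (x y : R) : `|x%:A + y *: I| <= `|x| + `|y|.
Proof.
apply: le_trans (ler_normD _ _) _; rewrite !normrZ.
have [_ ->] := SI; rewrite mulr1 (_ : `|1 : quat R| = 1) ?mulr1//.
by rewrite quat_normE /qdot /= !mulr0 !addr0 mulr1 sqrtr1.
Qed.

(** Left multiplication by [I] is antisymmetric for the scalar product, so
    pairing with [v] and [I * v] gives the two parts of a complex function. *)
Lemma slice_diff_holo (g : quat R -> quat R) q (v : quat R) (x y : R) :
  slice_diff g I (chart q x y) ->
  holo (fun x y => qdot (g (chart q x y)) v)
       (fun x y => qdot (g (chart q x y)) (I * v)) x y.
Proof.
move=> [D dD DI].
have lD a b : D (a%:A + b *: I) = a *: D 1 + b *: (I * D 1).
  by case: (dD) => _ <-; rewrite linearD !linearZ; case: dD => _ ->; rewrite DI.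
have key z : tdiff (fun x y => qdot (g (chart q x y)) z) x y
    (qdot (D 1) z) (qdot (I * D 1) z).
  move=> e e0; pose k := `|z| + 1.
  have k0 : 0 < k by rewrite ltr_wpDl.
  have [d d0 Hd] := is_diff_eps dD (divr_gt0 e0 k0).
  exists (d / 2) => [|s t sd td]; first by rewrite divr_gt0.
  have st := normq_chart_le s t.
  have sm : `|s%:A + t *: I| < d by lra.
  have le := Hd _ sm.
  rewrite chartD; set w := g (_ + _) - _ in le *.
  have -> : qdot (g (chart q x y + (s%:A + t *: I))) z - qdot (g (chart q x y)) z -
     (qdot (D 1) z * s + qdot (I * D 1) z * t) =
     qdot (w - D (s%:A + t *: I)) z.
    by rewrite lD /w !(qdotDl, qdotNl, qdotZl); ring.
  apply: le_trans (qdot_normr_le _ _) _.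
  apply: le_trans (_ : _ <= (e / k * (`|s| + `|t|)) * k) _; last first.
    by rewrite mulrAC divfK ?lt0r_neq0.
  apply: ler_pM => //; last by rewrite lerDl.
  by apply: le_trans le _; rewrite ler_pM2l// divr_gt0.
exists (qdot (D 1) v), (qdot (D 1) (I * v)); split.
  by rewrite -qdot_mulI; exact: key.
have := key (I * v).
by rewrite qdot_mulI mulrA (S2_sqr SI) mulN1r /qdot /= !mulrN -!opprD opprK.
Qed.

Lemma qdot_eq0 (p : quat R) : (forall v, qdot p v = 0) -> p = 0.
Proof.
move=> /(_ p) pp; apply: Defs.normq_eq0; apply/eqP.
by rewrite -sqrf_eq0 Defs.sqr_normq pp.
Qed.

Lemma spread_disk (g : quat R -> quat R) q (r s : R) : 0 < r -> 0 < s ->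
  (forall x y : R, `|x| < r -> `|y| < r -> slice_diff g I (chart q x y)) ->
  (forall x y : R, `|x| < s -> `|y| < s -> g (chart q x y) = 0) ->
  forall x y : R, x ^+ 2 + y ^+ 2 < r ^+ 2 -> g (chart q x y) = 0.
Proof.
move=> r0 s0 dg Z x y xyr; apply: qdot_eq0 => v.
apply: (@zero_disk R (fun x y => qdot (g (chart q x y)) v)
  (fun x y => qdot (g (chart q x y)) (I * v)) r s x y s0) => //.
  by move=> a b ar br; apply: slice_diff_holo; exact: dg.
move=> a b ar br; rewrite Z// /qdot /=; split; ring.
Qed.

Lemma spread_half (g : quat R -> quat R) q (r : R) :
  (forall x y : R, `|x| < r -> `|y| < r -> slice_diff g I (chart q x y)) ->
  (forall x : R, `|x| < r -> g (chart q x 0) = 0) ->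
  forall x y : R, `|x| < r / 4 -> 0 < y < r / 4 -> g (chart q x y) = 0.
Proof.
move=> dg Z x y xr yr; apply: qdot_eq0 => v.
apply: (@zero_half R (fun x y => qdot (g (chart q x y)) v)
  (fun x y => qdot (g (chart q x y)) (I * v)) r x y) => //.
  by move=> a b ar br; apply: slice_diff_holo; exact: dg.
move=> a ar; rewrite Z// /qdot /=; split; ring.
Qed.

Lemma Cplane_chart q (x y : R) : Cplane I q -> Cplane I (chart q x y).
Proof.
move=> [a [b ->]]; exists (a + x), (b + y).
by rewrite /chart !scalerDl addrACA.
Qed.

Lemma Cplane_chartP p q : Cplane I p -> Cplane I q -> exists x y : R,
  q = chart p x y /\ x ^+ 2 + y ^+ 2 = `|q - p| ^+ 2.
Proof.
move=> [a [b ->]] [c [d ->]]; exists (c - a), (d - b).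
have e : c%:A + d *: I - (a%:A + b *: I) = (c - a)%:A + (d - b) *: I.
  by rewrite !scalerBl opprD addrACA.
split; last by rewrite e normq_slice.
by rewrite /chart -e [RHS]addrC subrK.
Qed.

Lemma abs_lt_of_sqr (x y r : R) : 0 < r -> x ^+ 2 + y ^+ 2 < r ^+ 2 -> `|x| < r.
Proof.
move=> r0 h; rewrite -ltr_sqr ?nnegrE ?(ltW r0)// real_normK ?num_real//.
by apply: le_lt_trans h; rewrite lerDl sqr_ge0.
Qed.

(** The points near which [g] vanishes along the slice form a relatively open
    set. It is not empty by [spread_half], and relatively closed by
    [spread_disk]: a disk about a nearby point of the set covers the limit
    point. *)
Lemma slice_identity (L : set (quat R)) (g : quat R -> quat R) :
  open L -> connected (L `&` Cplane I) ->
  L `&` range (fun x : R => x%:A) !=set0 ->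
  (forall q, L q -> Cplane I q -> slice_diff g I q) ->
  (forall x : R, L x%:A -> g x%:A = 0) ->
  forall q, L q -> Cplane I q -> g q = 0.
Proof.
move=> oL cL [z [Lx0 [x0 _ zE]]] dg Zr; rewrite -{z}zE in Lx0.
have ballL q : L q -> exists2 r : R, 0 < r & forall p, `|p - q| < r -> L p.
  by move=> Lq; apply/quat_nbhsP; exact: open_nbhs_nbhs.
pose V := L `&` Cplane I.
pose near0 : set (quat R) := (fun p : quat R => V p -> g p = 0)°.
have near0_open : open near0 by exact: open_interior.
have near0_box q : V q -> (exists2 s : R, 0 < s & forall x y : R, `|x| < s -> `|y| < s ->
    V (chart q x y) -> g (chart q x y) = 0) -> near0 q.
  move=> [Lq Cq] [s s0 Hs]; apply/quat_nbhsP; exists s => // p pq Vp.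
  have [x [y [e n]]] := Cplane_chartP Cq Vp.2; rewrite e in Vp *.
  have h : x ^+ 2 + y ^+ 2 < s ^+ 2 by rewrite n ltr_sqr ?nnegrE// ltW.
  apply: Hs => //; first exact: abs_lt_of_sqr h.
  by rewrite addrC in h; exact: abs_lt_of_sqr h.
have box_near0 q : V q -> near0 q -> exists2 s : R, 0 < s &
    forall x y : R, `|x| < s -> `|y| < s -> V (chart q x y) -> g (chart q x y) = 0.
  move=> _ /quat_nbhsP[r r0 Hr]; exists (r / 2) => [|x y xr yr]; first by rewrite divr_gt0.
  apply: Hr; rewrite /chart addrAC subrr add0r.
  by have := normq_chart_le x y; lra.
have C0 : Cplane I x0%:A by exists x0, 0; rewrite scale0r addr0.
have [r r0 Hr] := ballL _ Lx0.
have inL x y : `|x| < r / 2 -> `|y| < r / 2 -> V (chart x0%:A x y).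
  move=> xr yr; split; last exact: Cplane_chart.
  apply: Hr; rewrite /chart addrAC subrr add0r.
  by have := normq_chart_le x y; lra.
have half x y : `|x| < r / 8 -> 0 < y < r / 8 -> g (chart x0%:A x y) = 0.
  have e8 : r / 8 = r / 2 / 4 by field.
  rewrite e8 => xr yr; apply: (@spread_half g x0%:A (r / 2)) => //.
    by move=> a b ar br; have [La Ca] := inL a b ar br; exact: dg.
  move=> a ar; have [|La _] := inL a 0 ar; first by rewrite normr0 divr_gt0.
  by move: La; rewrite /chart scale0r addr0 -scalerDl; exact: Zr.
pose q1 := chart x0%:A 0 (r / 16).
have Vq1 : V q1 by apply: inL; rewrite ?normr0 ?gtr0_norm; lra.
have q1near : near0 q1.
  apply: near0_box => //; exists (r / 16) => [|x y xr]; first by rewrite divr_gt0.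
  rewrite ltr_norml => /andP[y1 y2] _; rewrite /q1 /chart -addrA.
  have -> : 0%:A + (r / 16) *: I + (x%:A + y *: I) = x%:A + (r / 16 + y) *: I.
    by rewrite scale0r add0r addrCA scalerDl.
  by apply: half; [lra|apply/andP; split; lra].
have clos q : V q -> closure (V `&` near0) q -> near0 q.
  move=> Vq cq; have [t t0 Ht] := ballL q Vq.1.
  have [|q2 [[Vq2 nq2] /= q2q]] := cq [set p | `|p - q| < t / 8].
    by apply/quat_nbhsP; exists (t / 8) => //; rewrite divr_gt0.
  have inL2 x y : `|x| < t / 4 -> `|y| < t / 4 -> V (chart q2 x y).
    move=> xt yt; split; last by apply: Cplane_chart; exact: Vq2.2.
    apply: Ht; rewrite /chart addrAC.
    have := ler_normD (q2 - q) (x%:A + y *: I); have := normq_chart_le x y; lra.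
  have [s s0 Hs] := box_near0 _ Vq2 nq2.
  have zero : forall x y : R, x ^+ 2 + y ^+ 2 < (t / 4) ^+ 2 -> g (chart q2 x y) = 0.
    pose s1 := Num.min s (t / 4).
    apply: (@spread_disk g q2 (t / 4) s1); rewrite ?lt_min ?s0 ?divr_gt0//.
      by move=> a b ar br; have [La Ca] := inL2 a b ar br; exact: dg.
    move=> a b; rewrite !lt_min => /andP[a1 a2] /andP[b1 b2].
    by apply: Hs => //; exact: inL2.
  apply/quat_nbhsP; exists (t / 8) => [|p pq Vp]; first by rewrite divr_gt0.
  have [x [y [pE n]]] := Cplane_chartP Vq2.2 Vp.2; rewrite pE; apply: zero.
  have t4 : 0 <= t / 4 by rewrite divr_ge0// ltW.
  rewrite n ltr_sqr ?nnegrE//.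
  have -> : p - q2 = (p - q) + (q - q2) by rewrite addrA subrK.
  apply: le_lt_trans (ler_normD _ _) _; rewrite (distrC q q2).
  by apply: lt_le_trans (ltrD pq q2q) _; lra.
have VE : V `&` near0 = V.
  apply: cL; first by exists q1.
    by exists near0.
  exists (closure (V `&` near0)); first exact: closed_closure.
  apply/seteqP; split=> p [Vp np]; split=> //; last exact: clos.
  exact: subset_closure.
move=> q Lq Cq; have Vq : V q by [].
have [_ /nbhs_singleton] : (V `&` near0) q by rewrite VE.
by apply.
Qed.
End slice_identity.

(** * Orthonormal bases *)

Section orthonormal_basis.
Variables (R : realType) (i j : quat R).
Hypotheses (Si : S2 i) (Sj : S2 j) (ij0 : qdot i j = 0).

Lemma qre_mulC (p q : quat R) : qre (p * q) = qre (q * p).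
Proof. by rewrite /=; ring. Qed.

Lemma orthogonal_anticomm : j * i = - (i * j).
Proof.
have [r _] := S2P Si; have [s _] := S2P Sj; move: r s ij0; rewrite /qdot.
case: i => a b c d; case: j => a' b' c' d' /= -> -> h.
by apply: quat_eqP => /=; [rewrite -[RHS]add0r; lra | ring..].
Qed.

(** The vector part of [v] has zero cross product with [i] and with [j], so it is a
    multiple of both; since they are orthogonal, its square norm is zero. *)
Lemma commute_real (v : quat R) : i * v = v * i -> j * v = v * j -> v = (qre v)%:A.
Proof.
have [r n] := S2P Si; have [s m] := S2P Sj; move: r s n m ij0; rewrite /qdot quat_realE.
case: i => a1 a b c; case: j => d1 d e f; case: v => v0 p q r /= -> ->.
rewrite !mul0r !add0r => n m o hi hj.
have /= h1 := congr1 (@qi R) hi; have /= h2 := congr1 (@qj R) hi.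
have /= h3 := congr1 (@qk R) hi; have /= k1 := congr1 (@qi R) hj.
have /= k2 := congr1 (@qj R) hj; have /= k3 := congr1 (@qk R) hj.
rewrite !mul0r !mulr0 in h1 h2 h3 k1 k2 k3.
have x1 : q * c = r * b by lra.
have x2 : r * a = p * c by lra.
have x3 : p * b = q * a by lra.
have y1 : q * f = r * e by lra.
have y2 : r * d = p * f by lra.
have y3 : p * e = q * d by lra.
have pa : p = a * (p * a + q * b + r * c).
  have -> : a * (p * a + q * b + r * c) = p * (a * a) + (q * a) * b + (r * a) * c by ring.
  by rewrite -x3 x2 -[LHS]mulr1 -n; ring.
have qa : q = b * (p * a + q * b + r * c).
  have -> : b * (p * a + q * b + r * c) = (p * b) * a + q * (b * b) + (r * b) * c by ring.
  by rewrite x3 -x1 -[LHS]mulr1 -n; ring.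
have ra : r = c * (p * a + q * b + r * c).
  have -> : c * (p * a + q * b + r * c) = (p * c) * a + (q * c) * b + r * (c * c) by ring.
  by rewrite -x2 x1 -[LHS]mulr1 -n; ring.
have pd : p = d * (p * d + q * e + r * f).
  have -> : d * (p * d + q * e + r * f) = p * (d * d) + (q * d) * e + (r * d) * f by ring.
  by rewrite -y3 y2 -[LHS]mulr1 -m; ring.
have qd : q = e * (p * d + q * e + r * f).
  have -> : e * (p * d + q * e + r * f) = (p * e) * d + q * (e * e) + (r * e) * f by ring.
  by rewrite y3 -y1 -[LHS]mulr1 -m; ring.
have rd : r = f * (p * d + q * e + r * f).
  have -> : f * (p * d + q * e + r * f) = (p * f) * d + (q * f) * e + r * (f * f) by ring.
  by rewrite -y2 y1 -[LHS]mulr1 -m; ring.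
set S := p * a + _ + _ in pa qa ra; set T := p * d + _ + _ in pd qd rd.
have z : p * p + q * q + r * r = 0.
  have -> : p * p = (a * S) * (d * T) by rewrite -pa -pd.
  have -> : q * q = (b * S) * (e * T) by rewrite -qa -qd.
  have -> : r * r = (c * S) * (f * T) by rewrite -ra -rd.
  have -> : a * S * (d * T) + b * S * (e * T) + c * S * (f * T) =
     S * T * (a * d + b * e + c * f) by ring.
  by rewrite o mulr0.
have [p2 q2 r2] : [/\ 0 <= p * p, 0 <= q * q & 0 <= r * r] by rewrite -!expr2 !sqr_ge0.
have sq (t : R) : t * t = 0 -> t = 0 by move/eqP; rewrite mulf_eq0 orbb => /eqP.
by apply: quat_eqP => //=; apply: sq; lra.
Qed.

Definition frame : 4.-tuple (quat R) := [tuple 1; i; j; i * j].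

(** The sum commutes with [i] and [j], so it is real; its real part is found by
    cyclic invariance of the real part of a product. *)
Lemma frame_average (x : quat R) :
  \sum_k qconj (tnth frame k) * x * tnth frame k = (4 * qre x)%:A.
Proof.
rewrite !big_ord_recl big_ord0 addr0 !(tnth_nth 0) /=.
have conj1 : qconj 1 = 1 :> quat R by apply: quat_eqP; rewrite /= ?oppr0.
have [ri _] := S2P Si; have [rj _] := S2P Sj.
have i2 := S2_sqr Si; have j2 := S2_sqr Sj; have ji := orthogonal_anticomm.
rewrite conj1 !qconjM !qconj_re0// !mulrNN ji !mul1r !mulr1 !mulNr.
set s := _ + _.
have re_s : qre s = 4 * qre x.
  have reD (p q : quat R) : qre (p + q) = qre p + qre q by [].
  have reN (p : quat R) : qre (- p) = - qre p by [].
  have k2 : i * j * (i * j) = - 1 :> quat R.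
    by rewrite -mulrA (mulrA j) ji mulNr mulrN -mulrA j2 mulrN1 mulrN opprK i2.
  rewrite /s !(reD, reN) !(qre_mulC _ i) !(qre_mulC _ j) !(qre_mulC _ (i * j)).
  rewrite [i * (i * x)]mulrA [j * (j * x)]mulrA [i * j * (i * j * x)]mulrA.
  rewrite k2 i2 j2 !mulN1r !reN; ring.
have iji : i * j * i = j by rewrite -mulrA ji mulrN mulrA i2 mulN1r opprK.
have ijj : i * j * j = - i by rewrite -mulrA j2 mulrN1.
rewrite -re_s; apply: commute_real; rewrite /s.
  rewrite !(mulrDr, mulrDl, mulrN, mulNr).
  have -> : i * (i * x * i) = - (x * i) by rewrite !mulrA i2 !mulN1r mulNr.
  have -> : i * x * i * i = - (i * x) by rewrite -mulrA i2 mulrN1.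
  have -> : i * (i * j * x * (i * j)) = - (j * x * (i * j)).
    by rewrite !mulrA i2 !mulN1r !mulNr.
  have -> : j * x * j * i = - (j * x * (i * j)) by rewrite -mulrA ji mulrN.
  have -> : i * j * x * (i * j) * i = i * j * x * j.
    by rewrite -[LHS]mulrA iji.
  rewrite !opprK !mulrA.
  by rewrite [LHS]addrCA; do 2 congr (_ + _); rewrite addrC.
rewrite !(mulrDr, mulrDl, mulrN, mulNr).
have -> : j * (j * x * j) = - (x * j) by rewrite !mulrA j2 !mulN1r mulNr.
have -> : j * x * j * j = - (j * x) by rewrite -mulrA j2 mulrN1.
have -> : j * (i * x * i) = - (i * j * x * i) by rewrite !mulrA ji !mulNr.
have -> : j * (i * j * x * (i * j)) = i * x * (i * j).
  by rewrite !mulrA ji !mulNr ijj !mulNr opprK.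
have -> : i * j * x * (i * j) * j = - (i * j * x * i).
  by rewrite -[LHS]mulrA ijj mulrN.
have -> : i * x * i * j = i * x * (i * j) by rewrite mulrA.
rewrite !opprK.
by rewrite [LHS]addrA [RHS]addrA [RHS]addrC.
Qed.

Lemma frame_free (r : 'I_4 -> R) : \sum_k r k *: tnth frame k = 0 -> forall k, r k = 0.
Proof.
rewrite !big_ord_recl big_ord0 addr0 !(tnth_nth 0) /= => e k.
have [ri ni] := S2P Si; have [rj nj] := S2P Sj.
have re2 : qre (i * j) = 0.
  by move: ij0; rewrite /qdot /= ri rj; lra.
have oi : qdot (i * j) i = 0.
  have -> : qdot (i * j) i = qdot i i * qre j by rewrite /qdot /=; ring.
  by rewrite rj mulr0.
have oj : qdot (i * j) j = 0.
  have -> : qdot (i * j) j = qdot j j * qre i by rewrite /qdot /=; ring.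
  by rewrite ri mulr0.
have nij : qdot (i * j) (i * j) = 1.
  have -> : qdot (i * j) (i * j) = qdot i i * qdot j j by rewrite /qdot /=; ring.
  by rewrite ni nj mulr1.
have dC (p q : quat R) : qdot p q = qdot q p by rewrite /qdot; ring.
have d1 (p : quat R) : qdot 1 p = qre p by rewrite /qdot /=; ring.
have dot v : r ord0 * qre v + (r (lift ord0 ord0) * qdot i v +
   (r (lift ord0 (lift ord0 ord0)) * qdot j v +
    r (lift ord0 (lift ord0 (lift ord0 ord0))) * qdot (i * j) v)) = 0.
  have /(congr1 (fun p => qdot p v)) := e.
  by rewrite !qdotDl !qdotZl d1 => ->; rewrite /qdot /=; ring.
have := dot 1; have := dot i; have := dot j; have := dot (i * j).
rewrite !(dC _ 1) !d1 ri rj re2 ni nj nij oi oj (dC i (i * j)) (dC j (i * j)) (dC j i).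
rewrite oi oj ij0 !mulr0 !mulr1 !addr0 !add0r => e3 e2 e1 e0.
case: k => -[|[|[|[|//]]]] lt; [rewrite -e0|rewrite -e1|rewrite -e2|rewrite -e3];
  by congr r; apply: val_inj.
Qed.

End orthonormal_basis.

(** * Axially symmetric domains and the averaged real part *)

Section symmetric_domain.
Variables (R : realType) (L : set (quat R)).
Hypothesis sym : axially_symmetric L.

Lemma sqr_normq_vec (q : quat R) : `|q| ^+ 2 = qre q ^+ 2 + `|qvec q| ^+ 2.
Proof.
rewrite -[`|q|]/(Defs.normq q) -[`|qvec q|]/(Defs.normq (qvec q)) !Defs.sqr_normq.
by rewrite /qdot /=; ring.
Qed.

Lemma axially_symmetric_eq (p q : quat R) :
  qre p = qre q -> `|p| = `|q| -> L q -> L p.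
Proof.
move=> re_eq n_eq Lq; have [J SJ ->] := quat_slice p.
have : `|qvec p| ^+ 2 = `|qvec q| ^+ 2.
  by apply: (addrI (qre p ^+ 2)); rewrite {2}re_eq -!sqr_normq_vec n_eq.
move/eqP; rewrite eqrXn2// => /eqP ->; rewrite re_eq.
exact: sym.
Qed.

Lemma qre_unit_conj (u q : quat R) : qdot u u = 1 -> qre (qconj u * q * u) = qre q.
Proof.
move=> u1; rewrite -[RHS]mulr1 -u1; case: u {u1} => ????; case: q => ????.
by rewrite /qdot /=; ring.
Qed.

Lemma unit_mul_conj (u : quat R) : qdot u u = 1 -> u * qconj u = 1 /\ qconj u * u = 1.
Proof.
move=> u1; split; apply: quat_eqP => /=; try ring; rewrite -[RHS]u1 /qdot; ring.
Qed.

Lemma normq_unit (u : quat R) : qdot u u = 1 -> `|u| = 1.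
Proof. by move=> u1; rewrite quat_normE u1 sqrtr1. Qed.

Lemma normq_unit_conj (u q : quat R) : qdot u u = 1 -> `|qconj u * q * u| = `|q|.
Proof. by move=> /normq_unit u1; rewrite !normqM normq_conj u1 mulr1 mul1r. Qed.

Lemma domain_conj (q : quat R) : L q -> L (qconj q).
Proof. by apply: axially_symmetric_eq => //; rewrite normq_conj. Qed.

Definition rotated (u : quat R) (f : L -> quat R) : L -> quat R :=
  fun q => u * qext f (qconj u * val q * u) * qconj u.

Lemma SR_rotated (u : quat R) (f : L -> quat R) :
  qdot u u = 1 -> SR L f -> SR L (rotated u f).
Proof.
move=> u1; have [uv vu] := unit_mul_conj u1.
apply: SR_conjugate => // [I [r n]|q].
  by split; [rewrite qre_unit_conj|rewrite normq_unit_conj].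
split; apply: axially_symmetric_eq; by rewrite ?qre_unit_conj ?normq_unit_conj.
Qed.

(** At a fixed real point this is the known formula for the real part of a
    quaternion as a mean over the standard units; averaging the rotated functions
    rather than the values keeps slice regularity. *)
Definition real_part (f : L -> quat R) : L -> quat R :=
  4^-1 *: (rotated 1 f + (rotated (Quat 0 1 0 0) f +
     (rotated (Quat 0 0 1 0) f + rotated (Quat 0 0 0 1) f))).

Lemma SR_real_part (f : L -> quat R) : SR L f -> SR L (real_part f).
Proof.
move=> Sf; rewrite /real_part -[X in SR L X]addr0; apply: SR_lin; last exact: SR0.
rewrite -[rotated 1 f]scale1r; apply: SR_lin.
  by apply: SR_rotated; rewrite // /qdot /=; ring.
rewrite -[rotated (Quat 0 1 0 0) f]scale1r; apply: SR_lin.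
  by apply: SR_rotated; rewrite // /qdot /=; ring.
rewrite -[rotated (Quat 0 0 1 0) f]scale1r; apply: SR_lin.
  by apply: SR_rotated; rewrite // /qdot /=; ring.
by apply: SR_rotated; rewrite // /qdot /=; ring.
Qed.

Lemma real_part_real (f : L -> quat R) (q : L) (x : R) :
  val q = x%:A -> real_part f q = (qre (f q))%:A.
Proof.
move=> qx; have xC (u : quat R) : qdot u u = 1 -> qconj u * val q * u = val q.
  by move=> /unit_mul_conj[_ vu]; rewrite qx -scalerAr mulr1 -scalerAl vu.
rewrite /real_part !fctE /rotated !xC; try by rewrite /qdot /=; ring.
rewrite qext_in quat_realE.
by apply: quat_eqP => /=; field.
Qed.

End symmetric_domain.

(** * Schwarz reflection on a slice *)

Section reflection.
Variables (R : realType) (I : quat R).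
Hypothesis SI : S2 I.

(** Up to sign: split [v] into its part in the slice of [I] and the orthogonal
    part, drop the latter and conjugate the former. *)
Definition anti_slice (v : quat R) : quat R := 2^-1 *: (I * qconj v * I - qconj v).

Lemma anti_slice_linear : linear anti_slice.
Proof.
move=> a p q; rewrite /anti_slice linearP mulrDr mulrDl -scalerAr -scalerAl.
by rewrite opprD addrACA -scalerBr !scalerDr !scalerA mulrC.
Qed.

HB.instance Definition _ :=
  GRing.isLinear.Build R (quat R) (quat R) _ anti_slice anti_slice_linear.

Lemma anti_slice_continuous : continuous anti_slice.
Proof.
apply: (@bounded_continuous R anti_slice 1) => q; rewrite mul1r.
rewrite /anti_slice normrZ ger0_norm ?invr_ge0// ler_pdivrMl//.
apply: le_trans (ler_normB _ _) _.
by rewrite !normqM normq_conj; have [_ ->] := SI; rewrite mulr1 mul1r; lra.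
Qed.

Lemma anti_sliceM v : anti_slice (- I * v) = I * anti_slice v.
Proof.
have I2 := S2_sqr SI; have [rI _] := S2P SI.
rewrite /anti_slice qconjM (@qconj_re0 _ (- I)) ?opprK; last by rewrite /= rI oppr0.
rewrite -scalerAr mulrBr !mulrA I2 -!mulrA I2; congr (_ *: _).
by rewrite mulrN1 mulN1r mulrN addrC.
Qed.

(** The values lie in the slice of [I]; this is how [SRc_of_real] learns that a
    function which is real on the axis maps each slice to itself. *)
Lemma anti_slice_comm v : I * anti_slice v = anti_slice v * I.
Proof.
have I2 := S2_sqr SI.
rewrite /anti_slice -scalerAr -scalerAl mulrBr mulrBl; congr (_ *: _).
rewrite !mulrA I2 -!mulrA I2 mulrN1 mulN1r [RHS]addrC; congr (_ + _).
by rewrite mulrN.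
Qed.

Lemma anti_slice_commuting v : I * v = v * I -> anti_slice v = - qconj v.
Proof.
have I2 := S2_sqr SI; have [rI _] := S2P SI.
move=> /(congr1 (@qconj R)); rewrite !qconjM (qconj_re0 rI) mulrN mulNr => /oppr_inj e.
rewrite /anti_slice -e -mulrA I2 mulrN1 -opprD scalerN; congr (- _).
by rewrite -mulr2n -[qconj v *+ 2]scaler_nat scalerA mulVf ?scale1r// pnatr_eq0.
Qed.

End reflection.

(** * Uniqueness, the C-property and the decomposition *)

Section identity.
Variables (R : realType) (L : set (quat R)).
Hypotheses (sym : axially_symmetric L) (dom : s_domain L).

Lemma SR_eq0 (f : L -> quat R) : SR L f ->
  (forall (q : L) (x : R), val q = x%:A -> f q = 0) -> f = 0.
Proof.
move=> Sf f0; have [oL _ L0 cL] := dom; apply/funext => q.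
have [I SI e] := quat_slice (val q).
have Lq : L (val q) by apply: set_mem; exact: valP.
have Cq : Cplane I (val q) by rewrite e; exists (qre (val q)), `|qvec (val q)|.
rewrite -[LHS]qext_in; apply: (slice_identity SI oL (cL _ SI) L0 _ _ Lq Cq).
  by move=> _ /[swap] -[x [y ->]] Lxy; exact: SR_slice_diff.
move=> x Lx; have := qext_in f (SigSub (mem_set Lx)) => /= ->.
exact: (f0 _ x).
Qed.

(** Schwarz reflection: [h] plus its reflected copy is regular on the slice of [I]
    and vanishes at real points. Hence the values of [h] on this slice commute
    with [I], and there [anti_slice] is minus the conjugation. *)
Lemma SRc_of_real (h : L -> quat R) : SR L h ->
  (forall (q : L) (x : R), val q = x%:A -> h q = (qre (h q))%:A) -> SRc L h.
Proof.
move=> Sh hreal; split=> // p q pq; have [oL _ L0 cL] := dom.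
have [I SI e] := quat_slice (val q).
have inL (z : L) : L (val z) by apply: set_mem; exact: valP.
have refl z : L z -> Cplane I z ->
    (qext h + (anti_slice I \o qext h \o @qconj R)) z = 0.
  apply: (slice_identity SI oL (cL _ SI) L0).
    move=> _ /[swap] -[x [y ->]] Lxy; apply: slice_diffD; first exact: SR_slice_diff.
    have qcI : qconj I = - I by apply: qconj_re0; have [] := S2P SI.
    have qcxy : qconj (x%:A + y *: I) = x%:A + y *: - I.
      rewrite linearD !linearZ /= qcI; congr (_ *: _ + _).
      by apply: quat_eqP; rewrite /= ?oppr0.
    apply: slice_diff_comp.
    - exact: anti_slice_continuous.
    - exact: qconj_continuous.
    - by apply: quat_eqP; rewrite /= ?oppr0.
    - rewrite /= qcI qcxy; apply: SR_slice_diff => //; first exact: S2_opp.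
      by rewrite -qcxy; exact: domain_conj.
    - by move=> z1; rewrite /= qcI; exact: anti_sliceM.
  move=> x Lx; rewrite fctE /= (_ : qconj x%:A = x%:A); last first.
    by rewrite quat_realE; apply: quat_eqP; rewrite /= ?oppr0.
  have := qext_in h (SigSub (mem_set Lx)) => /= ->.
  rewrite (hreal _ x)//; set r := qre _.
  rewrite anti_slice_commuting//; last by rewrite -scalerAr -scalerAl mulr1 mul1r.
  rewrite quat_realE; apply: quat_eqP => /=; ring.
have Cq : Cplane I (val q) by rewrite e; exists (qre (val q)), `|qvec (val q)|.
have qp : val q = qconj (val p) by rewrite pq qconjK.
have Cp : Cplane I (val p).
  rewrite pq e; exists (qre (val q)), (- `|qvec (val q)|).
  rewrite linearD !linearZ /= (@qconj_re0 _ I); last by have [] := S2P SI.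
  rewrite scalerN scaleNr; congr (_ *: _ + _).
  by apply: quat_eqP; rewrite /= ?oppr0.
have /eqP := refl _ (inL q) Cq; have /eqP := refl _ (inL p) Cp.
rewrite !fctE /= -pq -qp !qext_in !addr_eq0 => /eqP ep /eqP eq.
by rewrite eq anti_slice_commuting// ?opprK// ep mulrN mulNr anti_slice_comm.
Qed.

Lemma SRc_real_part (f : L -> quat R) : SR L f -> SRc L (real_part f).
Proof.
move=> Sf; apply: SRc_of_real; first exact: SR_real_part.
by move=> q x qx; rewrite (real_part_real f qx) /= mulr1.
Qed.

Lemma SRc_real (f : L -> quat R) (q : L) (x : R) : SRc L f -> val q = x%:A ->
  f q = (qre (f q))%:A.
Proof.
move=> [_ fc] qx; have /fc : val q = qconj (val q).
  by rewrite qx quat_realE; apply: quat_eqP; rewrite /= ?oppr0.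
rewrite quat_realE => e; apply: quat_eqP => //=.
- by have := congr1 (@qi R) e; rewrite /=; lra.
- by have := congr1 (@qj R) e; rewrite /=; lra.
- by have := congr1 (@qk R) e; rewrite /=; lra.
Qed.

Lemma SRc_lin (a : R) (f g : L -> quat R) : SRc L f -> SRc L g -> SRc L (a *: f + g).
Proof.
move=> [Sf cf] [Sg cg]; split; first exact: SR_lin.
by move=> p q pq; rewrite !fctE (cf _ _ pq) (cg _ _ pq) linearP.
Qed.

Lemma SRc0 : SRc L 0.
Proof. by split; [exact: SR0|move=> p q _; rewrite linear0]. Qed.

Variables (i j : quat R).
Hypotheses (Si : S2 i) (Sj : S2 j) (ij0 : qdot i j = 0).
Local Notation e := (tnth (frame i j)).

(** Summing over the frame first leaves the factor [4 * qre u], which singles out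
    the unit [1] among the four rotations. *)
Lemma sum_real_part (f : L -> quat R) (q : L) :
  \sum_k real_part (fun q => f q * qconj (e k)) q * e k = f q.
Proof.
have ext a : qext (fun q => f q * a) = (fun q => qext f q * a) :> (quat R -> quat R).
  by apply: qextE => [z|z Lz]; rewrite ?qext_in// qext_out// mul0r.
have rot u : \sum_k rotated u (fun q => f q * qconj (e k)) q * e k =
    u * qext f (qconj u * val q * u) * (4 * qre u)%:A.
  rewrite -(frame_average Si Sj ij0 (qconj u)) mulr_sumr; apply: eq_bigr => k _.
  by rewrite /rotated ext !mulrA.
rewrite /real_part; under eq_bigr do rewrite !fctE -scalerAl !mulrDl.
rewrite -scaler_sumr !big_split /= !rot /= !mulr0 scale0r !mulr0 !addr0 mulr1.
have c1 : qconj 1 = 1 :> quat R by apply: quat_eqP; rewrite /= ?oppr0.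
rewrite c1 !mul1r mulr1 qext_in -scalerAr mulr1 scalerA mulVf ?scale1r//.
Qed.

End identity.

Theorem proposition3p12 (R : realType) (L : set (quat R)) (i j : quat R) :
  axially_symmetric L -> s_domain L ->
  S2 i -> S2 j -> qdot i j = 0 ->
  direct_sum_of (SR L)
    (tnth [tuple SRc L; SRc_mul L i; SRc_mul L j; SRc_mul L (i * j)]).
Proof.
move=> sym dom Si Sj ij0; pose e := tnth (frame i j).
have WE k : tnth [tuple SRc L; SRc_mul L i; SRc_mul L j; SRc_mul L (i * j)] k =
    SRc_mul L (e k).
  case: k => -[|[|[|[|//]]]] lt; rewrite /e (tnth_nth (SRc L)) (tnth_nth 0) //=.
  apply/seteqP; split=> f; first by move=> Sf; exists f => //; apply/funext => q; rewrite mulr1.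
  by move=> [g Sg <-]; under eq_fun do rewrite mulr1.
split.
- move=> k; split; rewrite ?inE ?WE.
    by exists 0; [exact: SRc0|apply/funext => q; rewrite mul0r].
  move=> a f g; rewrite !inE => -[f' Sf <-] [g' Sg <-].
  exists (a *: f' + g'); first exact: SRc_lin.
  by apply/funext => q; rewrite !fctE mulrDl scalerAl.
- apply/seteqP; split=> [f Sf|_ [w Ww <-]].
    pose w k (q : L) := real_part (fun q => f q * qconj (e k)) q * e k.
    exists w; last by apply/funext => q; rewrite fct_sumE; exact: sum_real_part.
    move=> k; rewrite WE; exists (real_part (fun q => f q * qconj (e k))) => //.
    by apply: SRc_real_part => //; exact: SR_mulr.
  have Sw k : SR L (w k).
    by have := Ww k; rewrite WE => -[g [Sg _] <-]; exact: SR_mulr.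
  elim/big_ind : _ => [|f g Sf Sg|k _]; [exact: SR0| |exact: Sw].
  by rewrite -[f]scale1r; exact: SR_lin.
- move=> w w' Ww Ww' eqw.
  have /choice[f Hf] k : exists f, SRc L f /\ w k = (fun q => f q * e k).
    by have := Ww k; rewrite WE => -[g Sg <-]; exists g.
  have /choice[f' Hf'] k : exists f, SRc L f /\ w' k = (fun q => f q * e k).
    by have := Ww' k; rewrite WE => -[g Sg <-]; exists g.
  pose d k := - 1 *: f' k + f k.
  have Sd k : SRc L (d k) by apply: SRc_lin; [case: (Hf' k)|case: (Hf k)].
  have sum0 q : \sum_k d k q * e k = 0.
    have /(congr1 (@^~ q)) := eqw; rewrite !fct_sumE => /eqP.
    rewrite -subr_eq0 -sumrB => /eqP h; rewrite -[RHS]h; apply: eq_bigr => k _.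
    by rewrite /d !fctE (Hf k).2 (Hf' k).2 mulrDl scaleN1r mulNr addrC.
  move=> k; have d0 : d k = 0.
    apply: (SR_eq0 dom (Sd k).1) => q x qx.
    have real l := SRc_real (Sd l) qx.
    rewrite real (_ : qre (d k q) = 0) ?scale0r//.
    apply: (frame_free Si Sj ij0 (r := fun l => qre (d l q))).
    rewrite -[RHS](sum0 q); apply: eq_bigr => l _.
    by rewrite [in RHS]real -scalerAl mul1r.
  rewrite (Hf k).2 (Hf' k).2; apply/funext => q; congr (_ * _).
  have /(congr1 (@^~ q)) := d0; rewrite /d !fctE scaleN1r addrC => /eqP.
  by rewrite subr_eq0 => /eqP.
Qed.
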